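(* Let $n\ge 10$ be an integer. Then the smallest type of chiral $3$-polytopes of order $2^n$ is $\{4,8\}$; that is, there is no chiral $3$-polytope of type $\{4,4\}$ with automorphism group of order $2^n$, while there exists a chiral $3$-polytope of type $\{4,8\}$ with automorphism group of order $2^n$. Moreover, the carrier surface of a chiral $3$-polytope of type $\{4,8\}$ with automorphism group of order $2^n$ has Euler characteristic $\chi=-2^{n-3}$ (equivalently, genus $g=2^{n-4}+1$).
   Context: A $3$-polytope (abstract polytope of rank $3$) is a partially ordered set $\mathcal{P}$ with a strictly monotone rank function with range $\{-1,0,1,2,3\}$ such that: (P1) there is a least face $F_{-1}$ and a greatest face $F_3$; (P2) every flag (maximal chain) has exactly $5$ elements; (P3) any two flags $\Phi,\Psi$ can be joined by a sequence of flags $\Phi=\Phi_0,\dots,\Phi_k=\Psi$, consecutive ones being adjacent (differing in exactly one element), with every $\Phi_i$ containing $\Phi\cap\Psi$; (P4) if $F<G$ have ranks $i-1$ and $i+1$ with $0\le i\le 2$, there are exactly two elements $H$ of rank $i$ with $F<H<G$. Elements of ranks $0,1,2$ are called vertices, edges and $2$-faces. $\mathcal{P}$ has type $\{k_1,k_2\}$ if every $2$-face is incident with exactly $k_1$ edges (and $k_1$ vertices) and every vertex is incident with exactly $k_2$ edges (and $k_2$ $2$-faces). An automorphism of $\mathcal{P}$ is an order-preserving permutation of its elements (with order-preserving inverse). The order of $\mathcal{P}$ means the order of its automorphism group. $\mathcal{P}$ is chiral if its automorphism group has exactly two orbits on flags, with any two adjacent flags lying in different orbits. Types of $3$-polytopes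 of order $2^n$ are considered here in the form $\{2^{k_1},2^{k_2}\}$ with $k_1,k_2>1$, so that $\{4,4\}$ would be the smallest conceivable type, and types are compared up to duality (interchange of the two entries). The carrier surface of a finite chiral $3$-polytope is the closed surface obtained by realizing each $2$-face as a polygonal disc and gluing these along common edges; it is orientable, and its Euler characteristic is $\chi=V-E+F=2-2g$, where $V,E,F$ are the numbers of vertices, edges and $2$-faces and $g$ is the genus. *)

(* Defs.v *)
From HB Require Import structures.
From mathcomp Require Import all_boot all_order all_algebra.
From mathcomp Require Import boolp classical_sets functions cardinality.

Set Implicit Arguments.
Unset Strict Implicit.
Unset Printing Implicit Defensive.

Import Order.TTheory GRing.Theory Num.Theory.
Local Open Scope classical_set_scope.
Local Open Scope ring_scope.
Local Open Scope card_scope.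

(* The carrier is an arbitrary, possibly infinite, poset, and
   "A has exactly k elements" is A #= `I_k. *)
Section Flags.
Context {d : Order.disp_t} {T : porderType d}.

Definition flag (Phi : set T) : Prop :=
  total_on Phi (fun x y : T => (x <= y)%O) /\
  forall C : set T, total_on C (fun x y : T => (x <= y)%O) ->
    Phi `<=` C -> C = Phi.

Definition adjacent (Phi Psi : set T) : Prop :=
  exists x y, Phi `\` Psi = [set x] /\ Psi `\` Phi = [set y].

Definition strongly_flag_connected : Prop :=
  forall Phi Psi : set T, flag Phi -> flag Psi ->
  exists (k : nat) (c : nat -> set T),
    [/\ c 0%N = Phi, c k = Psi,
        forall i, (i <= k)%N -> flag (c i) /\ Phi `&` Psi `<=` c i &
        forall i, (i < k)%N -> adjacent (c i) (c i.+1)].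

End Flags.

Record polytope3 := Polytope3 {
  face_disp : Order.disp_t;
  face :> porderType face_disp;
  rank : face -> int;
  rank_mono : {homo rank : x y / (x < y)%O >-> x < y};
  rank_range : range rank = [set i : int | -1 <= i <= 3];
  least_face : exists x : face, forall y : face, (x <= y)%O;
  greatest_face : exists x : face, forall y : face, (y <= x)%O;
  flag_card : forall Phi : set face, flag Phi -> Phi #= `I_5;
  flag_connected : @strongly_flag_connected face_disp face;
  diamond : forall (i : int) (F G : face), 0 <= i <= 2 ->
    (F < G)%O -> rank F = i - 1 -> rank G = i + 1 ->
    [set H : face | rank H = i /\ (F < H < G)%O] #= `I_2
}.

Definition faces_of_rank (P : polytope3) (i : int) : set P :=
  [set x : P | rank x = i].

(* Incidence of faces is comparability. *)
Definition incident_faces (P : polytope3) (x : P) (i : int) : set P :=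
  [set y : P | faces_of_rank i y /\ (x >=< y)%O].

Definition has_type (P : polytope3) (k1 k2 : nat) : Prop :=
  (forall F : P, rank F = 2 ->
     incident_faces F 1 #= `I_k1 /\ incident_faces F 0 #= `I_k1) /\
  (forall v : P, rank v = 0 ->
     incident_faces v 1 #= `I_k2 /\ incident_faces v 2 #= `I_k2).

Definition Aut (P : polytope3) : set (P -> P) :=
  [set f | exists g : P -> P,
     [/\ cancel f g, cancel g f, {homo f : x y / (x <= y)%O} &
         {homo g : x y / (x <= y)%O}]].

Definition has_order (P : polytope3) (N : nat) : Prop := @Aut P #= `I_N.

Definition flag_orbit (P : polytope3) (Phi : set P) : set (set P) :=
  [set f @` Phi | f in @Aut P].

Definition flag_orbits (P : polytope3) : set (set (set P)) :=
  [set flag_orbit Phi | Phi in [set Phi : set P | flag Phi]].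

Definition chiral (P : polytope3) : Prop :=
  @flag_orbits P #= `I_2 /\
  forall Phi Psi : set P, flag Phi -> flag Psi -> adjacent Phi Psi ->
    flag_orbit Phi <> flag_orbit Psi.

Definition chiral_of_order_type (N k1 k2 : nat) (P : polytope3) : Prop :=
  [/\ chiral P, has_order P N & has_type P k1 k2].

(* Order on types up to duality: unordered pairs, each listed in increasing
   order, are compared entrywise. *)
Definition type_le (k1 k2 l1 l2 : nat) : bool :=
  (minn k1 k2 <= minn l1 l2)%N && (maxn k1 k2 <= maxn l1 l2)%N.

Definition smallest_chiral_type (N k1 k2 : nat) : Prop :=
  (exists P, chiral_of_order_type N k1 k2 P) /\
  forall a b : nat, (1 < a)%N -> (1 < b)%N ->
    (exists P, chiral_of_order_type N (2 ^ a) (2 ^ b) P) ->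
    type_le k1 k2 (2 ^ a) (2 ^ b).

(* Euler characteristic V - E + F of the carrier surface, whose cells are the
   vertices, edges and 2-faces; it is a relation because it only makes sense
   when these are finite in number. *)
Definition euler_characteristic (P : polytope3) (chi : int) : Prop :=
  exists V E F : nat,
    [/\ @faces_of_rank P 0 #= `I_V, @faces_of_rank P 1 #= `I_E,
        @faces_of_rank P 2 #= `I_F & chi = V%:Z - E%:Z + F%:Z].

(* The carrier surface of a chiral polytope is closed and orientable, so its
   genus g is determined by chi = 2 - 2 g. *)
Definition carrier_genus (P : polytope3) (g : nat) : Prop :=
  euler_characteristic P (2 - 2 * g%:Z).

(* Main.v *)
Require Import Defs.
From HB Require Import structures.
From mathcomp Require Import all_boot all_order all_algebra.
From mathcomp Require Import fingroup perm action zify.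
From mathcomp Require Import boolp classical_sets functions cardinality.

(* A chiral polytope has two classes of flags, exchanged by adjacency, on each of
   which the automorphism group is simply transitive.

   Type {4,4}: a word in the three flag involutions that fixes a flag acts as a
   translation of the square tessellation, because half-turns and quarter-turns
   are conjugate to rotations without fixed flag.  The translations fixing a flag
   form an ideal of Z[i] that contains 2^n, so this ideal is generated by a power
   of 1 + i and is invariant under conjugation.  Hence the polytope has a
   reflection and is not chiral.

   Type {4,8}: the tessellation {4,4} of the torus Z[i] / (1 + i)^m is covered by
   means of voltages in an elementary abelian 2-group, read off modulo 4 on the
   edges.  Translations and rotations lift to the covering; every vertex has
   non-trivial curvature of order 2, which doubles the valency; and a closed walk
   that lifts to a closed walk, unlike its mirror image, excludes reflections.

   The Euler characteristic counts the 2^(n+1) flags by vertices, edges and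
   2-faces. *)

Set Implicit Arguments.
Unset Strict Implicit.
Unset Printing Implicit Defensive.

Import Order.TTheory GRing.Theory Num.Theory.
Local Open Scope classical_set_scope.
Local Open Scope ring_scope.
Local Open Scope card_scope.

(** Words in the flag exchanges [nbr i] commute with automorphisms, so flags of one orbit have the
    same stabiliser among words. This decides chirality: if every word fixing a flag also fixes an
    adjacent one, matching the images of the two flags under each word defines an automorphism
    exchanging them. For type {4,4}, the same observation applied to a flag and its rotated copy
    makes the translation ideal stable under multiplication by i; it contains 2^n because a
    translation moves a given flag as some automorphism does, and the order of that automorphism
    divides 2^n. For type {4,8} no group presentation is used. The points of the torus are the
    centres of 2-faces, voltages sit on the passages between neighbouring 2-faces, and the vertices
    are the unit squares of the lattice; the curvature of a square is what prevents a circuit around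
    it from closing after four steps. The voltages are preserved by translation and rotation only up
    to a linear map of the voltage group and a coboundary, which leaves room for asymmetry under
    reflection. *)

Section Cardinals.

Lemma card_range (J : finType) T (g : J -> T) :
  injective g -> range g #= `I_#|J|.
Proof.
move=> gI; apply: (card_eq_trans (B := [set: J])).
  by apply: inj_card_eq => x y _ _; apply: gI.
apply: card_esym; apply: card_eq_trans card_II _.
apply: card_esym; suff <- : range (@enum_rank J) = setT.
  by apply: card_esym; apply: inj_card_eq => x y _ _; apply: enum_rank_inj.
by apply/seteqP; split=> // i _; exists (enum_val i); rewrite ?enum_valK.
Qed.

Lemma card_eq_IP T (A : set T) n :
  A #= `I_n <-> exists2 g : 'I_n -> T, injective g & A = range g.
Proof.
split=> [cA|[g gI ->]]; last by have := card_range gI; rewrite card_ord.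
have : [set: 'I_n] #= A.
  apply: card_eq_trans (card_esym cA); apply: card_esym; exact: card_II.
move=> /card_bijP[f [f' fK f'K]].
have iT (i : 'I_n) : i \in [set: 'I_n] by rewrite inE.
pose g i := set_val (f (exist _ i (iT i))); exists g.
  move=> i j /val_inj/(can_inj fK) e; exact: (congr1 (@set_val _ _) e).
apply/seteqP; split=> [x Ax|_ [i _ <-]]; last by apply: set_valP.
have xA : x \in A by rewrite inE.
exists (set_val (f' (exist _ x xA))) => //; rewrite /g.
rewrite (_ : exist _ _ _ = f' (exist _ x xA)) ?f'K //.
by apply: val_inj.
Qed.

Lemma card_eq2 T (A : set T) x :
  A #= `I_2 -> A x -> exists2 y, y <> x & A = [set x; y].
Proof.
case/card_eq_IP=> g gI -> [i _ <-].
exists (g (if i == ord0 then ord_max else ord0)).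
  by move/gI; case: eqP => [->|/nesym].
apply/seteqP; split=> [_ [j _ <-]|y [->|->]]; [|by exists i|by eexists].
have [->|ji] := eqVneq j i; first by left.
right; congr g; apply/val_inj.
by case: i j ji => [[|[|//]] i] [[|[|//]] j].
Qed.

Lemma card_set2 T (x y : T) : x <> y -> [set x; y] #= `I_2.
Proof.
move=> xy; apply/card_eq_IP; exists (fun i : 'I_2 => if i == 0 then x else y).
  move=> i j; case: eqP => [->|/eqP i0]; case: eqP => [->|/eqP j0] //.
  - by move/esym.
  - by move=> _; apply: val_inj; case: i j i0 j0 => [[|[|//]] i] [[|[|//]] j].
apply/seteqP; split=> [z [->|->]|_ [i _ <-]].
- by exists 0.
- by exists 1.
- by case: ifP => _; [left|right].
Qed.

Lemma card_fibers T U (f : T -> U) (A : set T) (B : set U) b k :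
  (forall x, A x -> B (f x)) ->
  (forall y, B y -> [set x | A x /\ f x = y] #= `I_k) ->
  B #= `I_b -> A #= `I_(b * k)%N.
Proof.
move=> fAB fib /card_eq_IP[h hI Bh].
have fibh i : exists g : 'I_k -> T,
    injective g /\ [set x | A x /\ f x = h i] = range g.
  have Bi : B (h i) by rewrite Bh; exists i.
  by have /card_eq_IP[g] := fib _ Bi; exists g.
have [g gP] := choice fibh.
have gE i j : A (g i j) /\ f (g i j) = h i.
  suff: range (g i) (g i j) by rewrite -(gP i).2.
  by exists j.
have <- : range (fun p : 'I_b * 'I_k => g p.1 p.2) = A.
  apply/seteqP; split=> [_ [p _ <-]|x Ax]; first by have [] := gE p.1 p.2.
  have := fAB x Ax; rewrite Bh => -[i _ ih].
  have : range (g i) x by rewrite -(gP i).2 ih.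
  by case=> j _ <-; exists (i, j).
rewrite (_ : (b * k)%N = #|{: 'I_b * 'I_k}|); last by rewrite card_prod !card_ord.
apply: card_range => -[i j] [i' j'] /= e.
have ii : i = i' by apply: hI; rewrite -(gE i j).2 -(gE i' j').2 e.
by rewrite -ii in e *; rewrite ((gP i).1 _ _ e).
Qed.

(** Counts the base from the total: the number of flags is known and numbers of faces are wanted.
    Non-empty fibres make [f] onto, so finiteness passes to [B]. *)
Lemma card_fibers_base T U (f : T -> U) (A : set T) (B : set U) N k :
  (0 < k)%N -> (forall x, A x -> B (f x)) ->
  (forall y, B y -> [set x | A x /\ f x = y] #= `I_k) ->
  A #= `I_N -> exists2 b, B #= `I_b & N = (b * k)%N.
Proof.
move=> k0 fAB fib cA.
have BE : B = f @` A.
  apply/seteqP; split=> [y By|_ [x Ax <-]]; last exact: fAB.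
  have /card_eq_IP[g _ gE] := fib y By.
  have : range g (g (Ordinal k0)) by exists (Ordinal k0).
  by rewrite -gE => -[Ax xy]; exists (g (Ordinal k0)).
have : finite_set B by rewrite BE; apply: finite_image; apply/finite_setP; exists N.
case/finite_setP=> b cB; exists b => //.
apply/card_eq_II; apply: card_eq_trans (card_esym cA) _; exact: (card_fibers fAB fib cB).
Qed.

End Cardinals.

(** * Flags of a polytope *)

Section ChainExtension.
Context {d : Order.disp_t} {T : porderType d}.

Lemma chain_sub_flag (C : set T) :
  total_on C (fun x y : T => (x <= y)%O) -> exists2 Phi, flag Phi & C `<=` Phi.
Proof.
move=> totC.
have [|A [totA Amax]] :=
    @Zorn_bigcup _ (fun A => total_on (A `|` C) (fun x y : T => (x <= y)%O)).
  move=> F FP Fch x y [[X FX Xx]|Cx] [[Y FY Yy]|Cy].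
  - by have [XY|YX] := Fch _ _ FX FY;
      [apply: (FP Y) | apply: (FP X)] => //; left=> //; auto.
  - by apply: (FP X) => //; [left|right].
  - by apply: (FP Y) => //; [right|left].
  - exact: totC.
exists (A `|` C); last by right.
split=> // D totD ACD; apply/seteqP; split=> // x Dx; left.
apply: contrapT => Ax; apply: (Amax D).
  by split=> [y Ay|/(_ x Dx)//]; apply: ACD; left.
rewrite (_ : D `|` C = D) //; apply/seteqP; split=> [y [//|Cy]|]; last by left.
by apply: ACD; right.
Qed.

End ChainExtension.

Section PolytopeFlags.
Variable P : polytope3.
Implicit Types (x y z : P) (C : set P) (i j : int).

Lemma rank_bounds x : -1 <= rank x <= 3.
Proof.
have : range (@rank P) (rank x) by exists x.
by rewrite rank_range.
Qed.

Lemma rank_le x y : (x <= y)%O -> rank x <= rank y.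
Proof. by rewrite le_eqVlt => /orP[/eqP->//|/rank_mono/ltW]. Qed.

Lemma rank_inj_comparable x y :
  (x <= y)%O \/ (y <= x)%O -> rank x = rank y -> x = y.
Proof.
by case; rewrite le_eqVlt => /orP[/eqP//|/rank_mono lt_r] e; move: lt_r; rewrite e ltxx.
Qed.

Lemma rank_lt_comparable x y :
  (x <= y)%O \/ (y <= x)%O -> rank x < rank y -> (x < y)%O.
Proof.
case=> [|yx lt_r]; last by have := rank_le yx; lia.
by rewrite le_eqVlt => /orP[/eqP->|//]; rewrite ltxx.
Qed.

Lemma rank_least x y : rank x = -1 -> (x <= y)%O.
Proof.
move=> rx; have [z lez] := least_face P; suff -> : x = z by [].
apply: rank_inj_comparable; first by right.
by have := rank_le (lez x); have := rank_bounds z; lia.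
Qed.

Lemma rank_greatest x y : rank x = 3 -> (y <= x)%O.
Proof.
move=> rx; have [z lez] := greatest_face P; suff -> : x = z by [].
apply: rank_inj_comparable; first by left.
by have := rank_le (lez x); have := rank_bounds z; lia.
Qed.

(** Comparable faces of equal rank coincide, so a chain meets each rank at most once, and five
    elements must fill the five ranks. This replaces maximality by a condition that can be checked
    rank by rank. *)
Lemma flag_full C : flag C <->
  total_on C (fun x y => (x <= y)%O) /\
  forall i, -1 <= i <= 3 -> exists2 x, C x & rank x = i.
Proof.
split=> [flC|[totC fullC]]; last first.
  split=> // D totD CD; apply/seteqP; split=> // x Dx.
  have [y Cy yx] := fullC _ (rank_bounds x).
  by rewrite (_ : x = y) //; apply: rank_inj_comparable => //; apply: totD; auto.
split; first exact: flC.1.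
move=> i ib; have /card_eq_IP[g gI gE] := flag_card flC.
pose h (k : 'I_5) : 'I_5 := inord (absz (rank (g k) + 1)).
have hE k : (h k)%:Z = rank (g k) + 1.
  by have := rank_bounds (g k); rewrite /h => kb; rewrite inordK; lia.
have hI : injective h.
  move=> k l /(congr1 (fun m : 'I_5 => m%:Z)); rewrite !hE => e; apply: gI.
  apply: rank_inj_comparable; last lia.
  by apply: flC.1; rewrite gE; eexists.
have [h' _ h'K] := injF_bij hI.
exists (g (h' (inord (absz (i + 1))))); first by rewrite gE; eexists.
have := hE (h' (inord (absz (i + 1)))); rewrite h'K inordK; lia.
Qed.

Record flag_of := FlagOf { flag_set :> set P; flag_setP : flag flag_set }.
Implicit Types t : flag_of.

Lemma flag_of_inj t t' : t = t' :> set P -> t = t'.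
Proof. by case: t t' => [A fA] [B fB] /= e; subst B; congr FlagOf. Qed.

Definition bottom : P := sval (cid (least_face P)).

(** Outside the ranks -1 to 3 the default [bottom] is the same for all flags, so agreement of two
    flags can be stated for every integer rank. *)
Definition el t i : P := xget bottom [set x | flag_set t x /\ rank x = i].

Lemma elP t i : -1 <= i <= 3 -> flag_set t (el t i) /\ rank (el t i) = i.
Proof.
move=> ib; have [_ full] := (flag_full t).1 (flag_setP t).
have [x tx xi] := full i ib.
by apply: (xgetI bottom (x := x) (P := [set x | flag_set t x /\ rank x = i])).
Qed.

Lemma rank_el t i : -1 <= i <= 3 -> rank (el t i) = i.
Proof. by case/(elP t). Qed.

Lemma el_eq t x : flag_set t x -> el t (rank x) = x.
Proof.
move=> tx; have [ty yx] := elP t (rank_bounds x).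
by apply: rank_inj_comparable => //; apply: (flag_setP t).1.
Qed.

Lemma el_lt t i j : -1 <= i -> i < j -> j <= 3 -> (el t i < el t j)%O.
Proof.
move=> ib ij jb; have ib' : -1 <= i <= 3 by lia.
have jb' : -1 <= j <= 3 by lia.
have [ti ei] := elP t ib'; have [tj ej] := elP t jb'.
apply: rank_lt_comparable; first exact: (flag_setP t).1.
by rewrite ei ej.
Qed.

Lemma el_outer t t' i : ~~ (0 <= i <= 2) -> el t i = el t' i.
Proof.
move=> ib; have [->|i1] := eqVneq i (-1).
  apply: rank_inj_comparable; last by rewrite !rank_el.
  by left; apply: rank_least; rewrite rank_el.
have [->|i3] := eqVneq i 3.
  apply: rank_inj_comparable; last by rewrite !rank_el.
  by left; apply: rank_greatest; rewrite rank_el.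
have out s : el s i = bottom.
  by apply: xgetPN => z [_ zi]; have := rank_bounds z; rewrite zi; lia.
by rewrite !out.
Qed.

Lemma flag_ext t t' :
  (forall i, 0 <= i <= 2 -> el t i = el t' i) -> t = t'.
Proof.
move=> e; have {}e i : el t i = el t' i.
  by have [/e|/el_outer] := boolP (0 <= i <= 2).
apply: flag_of_inj; apply/seteqP; split=> x tx.
  by rewrite -(el_eq tx) e; apply: (elP t' (rank_bounds x)).1.
by rewrite -(el_eq tx) -e; apply: (elP t (rank_bounds x)).1.
Qed.

Lemma flag_of_family (f : int -> P) :
  (forall i, -1 <= i <= 3 -> rank (f i) = i) ->
  (forall i j, -1 <= i -> i <= j -> j <= 3 -> (f i <= f j)%O) ->
  exists t, forall i, -1 <= i <= 3 -> el t i = f i.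
Proof.
move=> rf lef.
have fl : flag [set x | x = f (rank x)].
  apply/flag_full; split=> [x y /= -> ->|i ib]; last first.
    by exists (f i) => /=; rewrite ?rf.
  have [xy|yx] := leP (rank x) (rank y); [left|right].
    by have := rank_bounds x; have := rank_bounds y; move=> ? ?; apply: lef; lia.
  by have := rank_bounds x; have := rank_bounds y; move=> ? ?; apply: lef; lia.
exists (FlagOf fl) => i ib.
by rewrite -[in LHS](rf i ib) el_eq //=; rewrite rf.
Qed.

Lemma flag_through2 x y : (x <= y)%O ->
  exists t, el t (rank x) = x /\ el t (rank y) = y.
Proof.
move=> xy; have [|Phi fPhi sub] := @chain_sub_flag _ _ [set x; y].
  by move=> ? ? [->|->] [->|->]; auto.
by exists (FlagOf fPhi); split; apply: el_eq; apply: sub; [left|right].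
Qed.

Lemma flag_through x : exists t, el t (rank x) = x.
Proof. by have [t [tx _]] := flag_through2 (lexx x); exists t. Qed.

Lemma el_change t i x : 0 <= i <= 2 -> rank x = i ->
  (el t (i - 1) < x)%O -> (x < el t (i + 1))%O ->
  exists t', el t' i = x /\ forall j, j <> i -> el t' j = el t j.
Proof.
move=> ib rx lx xl.
have [||t' t'E] := @flag_of_family (fun j => if j == i then x else el t j).
- by move=> j jb; case: eqP => [->//|_]; rewrite rank_el.
- move=> j k jb jk kb.
  have mono a b : -1 <= a -> a <= b -> b <= 3 -> (el t a <= el t b)%O.
    move=> ab; rewrite (le_eqVlt a b) => /orP[/eqP->//|lt_ab] bb.
    by apply/ltW; apply: el_lt.
  case: (eqVneq j i) => [ji|/eqP ji]; case: (eqVneq k i) => [ki|/eqP ki] //.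
  + by apply: le_trans (ltW xl) _; apply: mono; lia.
  + by apply: le_trans _ (ltW lx); apply: mono; lia.
  + exact: mono.
exists t'; split=> [|j ji]; first by rewrite t'E ?eqxx //; lia.
have [jb|jb] := boolP (0 <= j <= 2); last exact: el_outer.
by rewrite t'E; [case: eqP | lia].
Qed.

Lemma diamond_el t i : 0 <= i <= 2 -> exists2 y, y <> el t i &
  [set x | rank x = i /\ (el t (i - 1) < x < el t (i + 1))%O] = [set el t i; y].
Proof.
move=> ib; apply: card_eq2; last first.
  split; first by apply: rank_el; lia.
  by apply/andP; split; apply: el_lt; lia.
apply: diamond => //.
- by apply: el_lt; lia.
- by apply: rank_el; lia.
- by apply: rank_el; lia.
Qed.

Lemma nbr_exists t i : 0 <= i <= 2 ->
  exists t', t' <> t /\ forall j, j <> i -> el t' j = el t j.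
Proof.
move=> ib; have [y yt yE] := diamond_el t ib.
have [ry /andP[ly yl]] : [set x | rank x = i /\
    (el t (i - 1) < x < el t (i + 1))%O] y by rewrite yE; right.
have [t' [t'i t'j]] := el_change ib ry ly yl.
by exists t'; split=> // e; apply: yt; rewrite -t'i e.
Qed.

Definition nbr i t : flag_of :=
  if pselect (exists t', t' <> t /\ forall j, j <> i -> el t' j = el t j)
  is left H then sval (cid H) else t.

Lemma nbr_neq i t : 0 <= i <= 2 -> nbr i t <> t.
Proof.
by rewrite /nbr => /(nbr_exists t); case: pselect => // H _; case: cid => t' [].
Qed.

Lemma el_nbr i t j : j <> i -> el (nbr i t) j = el t j.
Proof.
rewrite /nbr; case: pselect => // H; case: cid => t' [_ /= H1]; exact: H1.
Qed.

(* The face that replaces the i-face of a flag depends only on its faces of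
   ranks i - 1, i and i + 1. *)
Lemma nbr_local i t t' u : 0 <= i <= 2 ->
  (forall j, i - 1 <= j <= i + 1 -> el t j = el t' j) ->
  u <> t' -> (forall j, j <> i -> el u j = el t' j) -> el u i = el (nbr i t) i.
Proof.
move=> ib e ut uj; have [y yt yE] := diamond_el t ib.
have out v w : (forall j, i - 1 <= j <= i + 1 -> el t j = el w j) ->
    v <> w -> (forall j, j <> i -> el v j = el w j) -> el v i = y.
  move=> e' vw vj.
  have : [set x | rank x = i /\ (el t (i - 1) < x < el t (i + 1))%O] (el v i).
    split; first by rewrite rank_el //; lia.
    by rewrite !e' -?vj; [apply/andP; split; apply: el_lt; lia| lia..].
  rewrite yE => -[vi|//]; case: vw; apply: flag_ext => j jb.
  by have [->|/eqP/vj//] := eqVneq j i; rewrite vi e' //; lia.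
rewrite (out u t') // (out (nbr i t) t) //; first exact: nbr_neq.
by move=> j ji; apply: el_nbr.
Qed.

Lemma nbr_uniq i t t' : 0 <= i <= 2 -> t' <> t ->
  (forall j, 0 <= j <= 2 -> j <> i -> el t' j = el t j) -> t' = nbr i t.
Proof.
move=> ib t't t'j; have {}t'j j : j <> i -> el t' j = el t j.
  by have [|/el_outer] := boolP (0 <= j <= 2); auto.
apply: flag_ext => j jb.
have [->|/eqP ji] := eqVneq j i; last by rewrite t'j // el_nbr.
exact: (nbr_local ib (t := t) (t' := t)).
Qed.

Lemma nbrK i : 0 <= i <= 2 -> involutive (nbr i).
Proof.
move=> ib t; symmetry; apply: nbr_uniq => //; first exact/nesym/nbr_neq.
by move=> j _ ji; rewrite el_nbr.
Qed.

Lemma el_nbr_neq i t : 0 <= i <= 2 -> el (nbr i t) i <> el t i.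
Proof.
move=> ib e; apply: (nbr_neq ib (t := t)); apply: flag_ext => j _.
by have [->//|/eqP ji] := eqVneq j i; rewrite el_nbr.
Qed.

(** The new vertex depends only on the faces of ranks -1, 0, 1 and the new 2-face only on those of
    ranks 1, 2, 3, so neither exchange influences the other. *)
Lemma nbr_comm02 t : nbr 0 (nbr 2 t) = nbr 2 (nbr 0 t).
Proof.
apply: flag_ext => j jb.
have [->|/eqP j0] := eqVneq j 0.
  rewrite [RHS]el_nbr //; apply: (@nbr_local _ _ (nbr 2 t)) => //.
  - by move=> k kb; rewrite el_nbr //; lia.
  - exact: nbr_neq.
  - by move=> k k0; rewrite el_nbr.
rewrite el_nbr //; have [->|/eqP j2] := eqVneq j 2; last by rewrite !el_nbr.
symmetry; apply: (@nbr_local _ _ (nbr 0 t)) => //.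
- by move=> k kb; rewrite el_nbr //; lia.
- exact: nbr_neq.
- by move=> k k0; rewrite el_nbr.
Qed.

Lemma adjacent_nbr i t : 0 <= i <= 2 -> adjacent t (nbr i t).
Proof.
have diff u v : 0 <= i <= 2 -> (forall j, j <> i -> el u j = el v j) ->
    el u i <> el v i -> u `\` v = [set el u i].
  move=> ib uv ni; have ib' : -1 <= i <= 3 by lia.
  apply/seteqP; split=> [x [ux vx]|_ ->]; last first.
    split; first exact: (elP u ib').1.
    by move=> /el_eq; rewrite rank_el // => /esym.
  have [<-|/eqP xi] := eqVneq (rank x) i; first by rewrite /= el_eq.
  by case: vx; rewrite -(el_eq ux) uv //; apply: (elP v (rank_bounds x)).1.
move=> ib; exists (el t i), (el (nbr i t) i); split; apply: diff => //.
- by move=> j ji; rewrite el_nbr.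
- exact/nesym/el_nbr_neq.
- by move=> j ji; rewrite el_nbr.
- exact/el_nbr_neq.
Qed.

Lemma adjacentP t t' : adjacent t t' -> exists2 i, 0 <= i <= 2 & t' = nbr i t.
Proof.
move=> [x [y [xE yE]]].
have [tx t'x] : (t `\` t') x by rewrite xE.
have agree j : j <> rank x -> el t' j = el t j.
  move=> jx; have [jb|] := boolP (0 <= j <= 2); last exact: el_outer.
  have jb' : -1 <= j <= 3 by lia.
  have [tj rj] := elP t jb'; suff t'j : flag_set t' (el t j).
    by rewrite -[in LHS]rj el_eq.
  apply: contrapT => t'j; have : (t `\` t') (el t j) by [].
  by rewrite xE => jE; apply: jx; rewrite -rj jE.
have tt' : t' <> t by move=> e; apply: t'x; rewrite e.
exists (rank x).
  have [//|ib] := boolP (0 <= rank x <= 2).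
  case: tt'; apply: flag_ext => j jb; apply: agree => jx.
  by rewrite -jx jb in ib.
apply: nbr_uniq => // [|j _]; last exact: agree.
have [//|ib] := boolP (0 <= rank x <= 2).
case: tt'; apply: flag_ext => j jb; apply: agree => jx.
by rewrite -jx jb in ib.
Qed.

(** The path of flags given by (P3) keeps all common faces of [t] and [t'], so its steps change only
    ranks at which the two differ. Later arguments rest on this restriction of the letters. *)
Lemma flags_connected t t' : exists2 w : seq int,
  (forall i, i \in w -> 0 <= i <= 2 /\ el t i <> el t' i) & t' = foldr nbr t w.
Proof.
have [k [c [c0 ck cfl cadj]]] := flag_connected (flag_setP t) (flag_setP t').
suff H m : (m <= k)%N -> exists2 w : seq int,
    (forall i, i \in w -> 0 <= i <= 2 /\ el t i <> el t' i) &
    c m = foldr nbr t w.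
  have [w wP e] := H k (leqnn k); exists w => //.
  by apply: flag_of_inj; rewrite -ck e.
elim: m => [_|m IH mk]; first by exists [::].
have [w wP cm] := IH (ltnW mk).
have [fl2 sub2] := cfl _ mk; have [_ sub1] := cfl _ (ltnW mk).
pose u := FlagOf fl2.
have adj : adjacent (foldr nbr t w) u by rewrite -cm; apply: cadj.
have [i ib uE] := adjacentP adj.
exists (i :: w); last by rewrite /= -uE.
move=> j; rewrite inE => /orP[/eqP->|/wP//]; split=> // e.
have ib' : -1 <= i <= 3 by lia.
have [ti ri] := elP t ib'.
have both : (t `&` t') (el t i) by split=> //; rewrite e; apply: (elP t' ib').1.
apply: (el_nbr_neq ib (t := foldr nbr t w)); rewrite -uE.
have -> : el u i = el t i by rewrite -[in LHS]ri el_eq //; apply: sub2.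
by rewrite -[in RHS]ri el_eq // -cm; apply: sub1.
Qed.

End PolytopeFlags.

(** * Automorphisms and parity *)

Section Automorphisms.
Variable P : polytope3.
Implicit Types (x y : P) (t u : flag_of P) (i j : int) (f g : P -> P).

Lemma Aut_id : Aut (@id P).
Proof. by exists id; split. Qed.

Lemma Aut_comp f g : Aut f -> Aut g -> Aut (f \o g).
Proof.
move=> [f' [fK f'K fm f'm]] [g' [gK g'K gm g'm]]; exists (g' \o f').
split; [exact: can_comp | exact: can_comp | |] => x y xy /=; auto.
Qed.

Lemma Aut_lt f x y : Aut f -> (x < y)%O -> (f x < f y)%O.
Proof.
move=> [f' [fK _ fm _]]; rewrite !lt_neqAle => /andP[xy /fm ->]; rewrite andbT.
by apply: contra_neq xy => /(can_inj fK).
Qed.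

(** Along the image of a flag the rank increases strictly four times within the five values -1 to 3,
    which leaves no choice. *)
Lemma Aut_rank f x : Aut f -> rank (f x) = rank x.
Proof.
move=> Af; have [t tx] := flag_through x.
suff H i : -1 <= i <= 3 -> rank (f (el t i)) = i.
  by rewrite -{1}tx H // rank_bounds.
have lt (k : int) : -1 <= k <= 2 -> rank (f (el t k)) < rank (f (el t (k + 1))).
  by move=> kb; apply/rank_mono/(Aut_lt Af)/el_lt; lia.
move: (lt (-1) isT) (lt 0 isT) (lt 1 isT) (lt 2 isT).
have := rank_bounds (f (el t (-1))); have := rank_bounds (f (el t 3)).
rewrite addNr add0r (_ : 1 + 1 = 2) // (_ : 2 + 1 = 3) //.
move=> b1 b2 l1 l2 l3 l4 ib.
have : i \in [:: -1; 0; 1; 2; 3 : int] by rewrite !inE; lia.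
rewrite !inE => /or4P[|||/orP[]] /eqP->;
  move: (rank _) (rank _) (rank _) (rank _) (rank _) b1 b2 l1 l2 l3 l4; lia.
Qed.

Lemma Aut_flag f t : Aut f -> flag (f @` flag_set t).
Proof.
move=> Af; have [tot full] := (flag_full t).1 (flag_setP t).
apply/flag_full; split=> [_ _ [x tx <-] [y ty <-]|i ib]; last first.
  by have [x tx xi] := full i ib; exists (f x); [exists x | rewrite Aut_rank].
by have [f' [_ _ fm _]] := Af; have [/fm|/fm] := tot x y tx ty; auto.
Qed.

Definition img f t : flag_of P :=
  if pselect (flag (f @` flag_set t)) is left H then FlagOf H else t.

Lemma imgE f t : Aut f -> img f t = f @` flag_set t :> set P.
Proof. by rewrite /img => /(Aut_flag t); case: pselect. Qed.

Lemma el_img f t i : Aut f -> -1 <= i <= 3 -> el (img f t) i = f (el t i).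
Proof.
move=> Af ib; have [ti ri] := elP t ib.
rewrite -[in LHS]ri -(Aut_rank (el t i) Af) el_eq // imgE //.
Qed.

Lemma img_nbr f t i : Aut f -> 0 <= i <= 2 -> img f (nbr i t) = nbr i (img f t).
Proof.
move=> Af ib; apply: nbr_uniq => // [e|j jb ji].
  apply: (@el_nbr_neq _ i t ib); have ib' : -1 <= i <= 3 by lia.
  have [f' [fK _ _ _]] := Af; apply: (can_inj fK).
  by rewrite -!el_img // e.
by rewrite !el_img ?el_nbr //; lia.
Qed.

Lemma img_comp f g t : Aut f -> Aut g -> img (f \o g) t = img f (img g t).
Proof.
move=> Af Ag; apply: flag_ext => i ib; have ib' : -1 <= i <= 3 by lia.
by rewrite !el_img //; apply: Aut_comp.
Qed.

Lemma img_id t : img id t = t.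
Proof.
apply: flag_ext => i ib; rewrite el_img //; first exact: Aut_id.
lia.
Qed.

Lemma img_foldr f t (w : seq int) : Aut f -> all (fun i => 0 <= i <= 2) w ->
  img f (foldr (@nbr P) t w) = foldr (@nbr P) (img f t) w.
Proof. by move=> Af; elim: w => //= i w IH /andP[ib /IH <-]; rewrite img_nbr. Qed.

Lemma flags_reach t u :
  exists2 w : seq int, all (fun i => 0 <= i <= 2) w & u = foldr (@nbr P) t w.
Proof.
have [w wP ->] := flags_connected t u; exists w => //.
by apply/allP => i /wP[].
Qed.

(** Automorphisms commute with [nbr], so the image of one flag determines the images of all flags
    and hence of all faces. *)
Lemma img_inj f g t : Aut f -> Aut g -> img f t = img g t -> f = g.
Proof.
move=> Af Ag e; apply: funext => x; have [u ux] := flag_through x.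
have [w wb uw] := flags_reach t u.
by rewrite -ux -!el_img ?rank_bounds // uw !img_foldr // e.
Qed.

(** A face is sent to the face of the same rank in the image of any flag through it. The choice of
    flag does not matter: two flags through a face are joined by a word that avoids its rank. *)
Lemma flag_map_Aut (th th' : flag_of P -> flag_of P) :
  cancel th th' -> cancel th' th ->
  (forall i t, 0 <= i <= 2 -> th (nbr i t) = nbr i (th t)) ->
  exists2 f, Aut f & forall t, img f t = th t.
Proof.
move=> thK th'K thN.
have th'N i t : 0 <= i <= 2 -> th' (nbr i t) = nbr i (th' t).
  by move=> ib; apply: (can_inj thK); rewrite thN // !th'K.
pose F (h : flag_of P -> flag_of P) x :=
  el (h (sval (cid (flag_through x)))) (rank x).
have FE h t i : (forall j s, 0 <= j <= 2 -> h (nbr j s) = nbr j (h s)) ->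
    -1 <= i <= 3 -> F h (el t i) = el (h t) i.
  move=> hN ib; rewrite /F; case: cid => u /=.
  rewrite rank_el // => uE.
  have [w wP ->] := flags_connected u t.
  elim: w wP => //= j w IH wP; have [jb uj] := wP j (mem_head _ _).
  rewrite hN // el_nbr; last by move=> ij; apply: uj; rewrite -ij.
  by apply: IH => k kw; apply: wP; rewrite inE kw orbT.
have Fm h : (forall j s, 0 <= j <= 2 -> h (nbr j s) = nbr j (h s)) ->
    {homo F h : x y / (x <= y)%O}.
  move=> hN x y xy; have [t [<- <-]] := flag_through2 xy.
  rewrite !FE ?rank_bounds //; move: (rank_le xy); rewrite (le_eqVlt (rank x)).
  case/orP=> [/eqP->//|lt_xy]; have := rank_bounds x; have := rank_bounds y.
  by move=> ? ?; apply/ltW/el_lt; lia.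
have FK h h' : (forall j s, 0 <= j <= 2 -> h (nbr j s) = nbr j (h s)) ->
    (forall j s, 0 <= j <= 2 -> h' (nbr j s) = nbr j (h' s)) ->
    cancel h h' -> cancel (F h) (F h').
  move=> hN h'N hK x; have [t tx] := flag_through x.
  by rewrite -{1}tx !FE ?rank_bounds // hK.
have Af : Aut (F th) by exists (F th'); split; auto.
exists (F th) => // t; apply: flag_ext => i ib; have ib' : -1 <= i <= 3 by lia.
by rewrite el_img // FE.
Qed.

(** With two orbits that adjacency exchanges, membership in the orbit of a base flag is a bit
    flipped by each [nbr]. Both the non-existence and the existence proof use chirality in this
    form. *)
Lemma chiral_parity : chiral P <-> exists par : flag_of P -> bool,
  (forall i t, 0 <= i <= 2 -> par (nbr i t) = ~~ par t) /\
  (forall t u, par t = par u <-> exists2 f, Aut f & img f t = u).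
Proof.
pose same t u := exists2 f, Aut f & img f t = u.
have sameE t u : same t u <-> flag_orbit t = flag_orbit u.
  split=> [[f Af fu]|e].
    have [f' [fK f'K fm f'm]] := Af.
    have Af' : Aut f' by exists f.
    apply/seteqP; split=> _ [g Ag <-].
      exists (g \o f'); first exact: Aut_comp.
      rewrite -fu imgE // -image_comp; congr image.
      by rewrite image_comp (_ : _ \o _ = id) ?image_id //; apply/funext.
    exists (g \o f); first exact: Aut_comp.
    by rewrite -image_comp -imgE // fu.
  have : flag_orbit u u by exists id; [exact: Aut_id | rewrite image_id].
  rewrite -e => -[f Af fE]; exists f => //.
  by apply: flag_of_inj; rewrite imgE.
split=> [[two adj]|[par [parN parP]]].
  have [t0 _] := flag_through (bottom P).
  have orb t : @flag_orbits P (flag_orbit t).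
    by exists t => //; exact: flag_setP.
  have [y yt0 E] := card_eq2 two (orb t0).
  have nN i t : 0 <= i <= 2 -> flag_orbit (nbr i t) <> flag_orbit t.
    move=> ib e; apply: (adj t (nbr i t)) => //; try exact: flag_setP.
    exact: adjacent_nbr.
  pose par t := `[< flag_orbit t = flag_orbit t0 >].
  have cases t : flag_orbit t = flag_orbit t0 \/ flag_orbit t = y.
    by have := orb t; rewrite E => -[]; auto.
  exists par; split=> [i t ib|t u].
    have := nN i t ib; rewrite /par.
    case: (cases t) => ->; case: (cases (nbr i t)) => -> //;
      do !case: asboolP => //.
  rewrite -/(same t u) sameE /par; split=> [|->//].
  case: (cases t) => ->; case: (cases u) => -> //; do !case: asboolP => //.
have [t0 _] := flag_through (bottom P).
split.
  rewrite (_ : @flag_orbits P = [set flag_orbit t0; flag_orbit (nbr 0 t0)]).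
    apply: card_set2 => /sameE/parP; rewrite parN //.
    by case: (par t0).
  apply/seteqP; split=> [_ [Phi fPhi <-]|_ [->|->]]; last 2 first.
  - by exists t0 => //; exact: flag_setP.
  - by exists (nbr 0 t0) => //; exact: flag_setP.
  have := parP (FlagOf fPhi) t0; have := parP (FlagOf fPhi) (nbr 0 t0).
  rewrite parN // -/(same _ _) => [[h1 _] [h2 _]].
  case: (par (FlagOf fPhi)) h1 h2; case: (par t0) => h1 h2.
  - by left; apply: (sameE (FlagOf fPhi) t0).1 (h2 erefl).
  - by right; apply: (sameE (FlagOf fPhi) (nbr 0 t0)).1 (h1 erefl).
  - by right; apply: (sameE (FlagOf fPhi) (nbr 0 t0)).1 (h1 erefl).
  - by left; apply: (sameE (FlagOf fPhi) t0).1 (h2 erefl).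
move=> Phi Psi fPhi fPsi adj.
have [i ib e] := @adjacentP _ (FlagOf fPhi) (FlagOf fPsi) adj.
move=> /(sameE (FlagOf fPhi) (FlagOf fPsi))/parP; rewrite e parN //.
by case: (par _).
Qed.

End Automorphisms.

(** * Periods of iterated injections *)

Section IterPeriod.

Lemma iter_period T (f : T -> T) x : injective f ->
  (exists2 q, (0 < q)%N & iter q f x = x) ->
  exists2 p, (0 < p)%N & forall k, iter k f x = x <-> (p %| k)%N.
Proof.
move=> fI [q q0 fq].
have ex : exists p, (0 < p)%N && `[< iter p f x = x >].
  by exists q; rewrite q0; apply/asboolP.
case: (ex_minnP ex) => p /andP[p0 /asboolP fp] pmin.
have mulp m : iter (m * p) f x = x by elim: m => // m IH; rewrite mulSn iterD IH.
exists p => // k; split=> [fk|/dvdnP[m ->]//].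
move: fk; rewrite {1}(divn_eq k p) addnC iterD mulp => fr.
rewrite /dvdn; apply: contraT; rewrite -lt0n => r0.
have := pmin (k %% p)%N; rewrite r0 leqNgt ltn_pmod //=.
by move=> H; apply: H; apply/asboolP.
Qed.

Lemma iter_inj T (f : T -> T) x a b : injective f ->
  iter a f x = iter (b + a) f x -> iter b f x = x.
Proof.
move=> fI; elim: a => [|a IH]; first by rewrite addn0.
by rewrite addnS !iterS => /fI.
Qed.

End IterPeriod.

(** * Rotations about vertices and 2-faces *)

Section Rotations.
Variables (P : polytope3) (par : flag_of P -> bool).
Hypothesis parN : forall i t, 0 <= i <= 2 -> par (nbr i t) = ~~ par t.
Implicit Types (t u : flag_of P) (i j : int).

(** For i = 0 this turns the flag about its 2-face, for i = 2 about its vertex: the face kept has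
    rank 2 - i. *)
Definition rot i t := nbr i (nbr 1 t).

Variable i : int.
Hypothesis i02 : i = 0 \/ i = 2.

Let ib : 0 <= i <= 2. Proof. by case: i02 => ->. Qed.
Let i1 : i <> 1. Proof. by case: i02 => ->. Qed.

Lemma rotK : cancel (rot i) (fun t => nbr 1 (nbr i t)).
Proof. by move=> t; rewrite /rot !nbrK. Qed.

Lemma el_rot t k : el (iter k (rot i) t) (2 - i) = el t (2 - i).
Proof.
elim: k => //= k <-; rewrite /rot !el_nbr //; first by case: i02 => ->.
by case: i02 => ->.
Qed.

Lemma par_rot t k : par (iter k (rot i) t) = par t.
Proof. by elim: k => //= k IH; rewrite /rot !parN // negbK. Qed.

(** Only the letters 1 and i keep the face, and [nbr 1] and [nbr i] generate a dihedral group: every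
    flag on the face is a rotated copy of [t] or the mirror image of one. *)
Lemma same_face_rot t u p : (0 < p)%N -> iter p (rot i) t = t ->
  el u (2 - i) = el t (2 - i) -> exists k : nat,
  u = iter k (rot i) t \/ u = nbr 1 (iter k (rot i) t).
Proof.
move=> p0 pt ut; have [w wP ->] := flags_connected t u.
have {}wP j : j \in w -> j = 1 \/ j = i.
  move=> /wP[jb tj]; have : j <> 2 - i by move=> e; apply: tj; rewrite e ut.
  by case: i02 => -> => h; lia.
elim: w wP => [_|j w IH wP] /=; first by exists 0%N; left.
have [|k] := IH; first by move=> l lw; apply: wP; rewrite inE lw orbT.
have [-> [->|->]|-> [->|->]] := wP j (mem_head _ _).
- by exists k; right.
- by exists k; left; rewrite nbrK.
- case: k => [|k]; last by exists k; right; rewrite /= /rot nbrK.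
  (* The exponent -1 is needed here; the period turns it into p - 1. *)
  by exists p.-1; right; rewrite /= -{1}pt -(prednK p0) /= /rot nbrK.
- by exists k.+1; left.
Qed.

(** The two flags already share the face of rank 2 - i. Sharing one more face makes them equal or
    adjacent, and rotations preserve parity, which excludes adjacency. *)
Lemma rot_sep t a b j : j = 1 \/ j = i ->
  el (iter a (rot i) t) j = el (iter b (rot i) t) j ->
  iter a (rot i) t = iter b (rot i) t.
Proof.
set u := iter a _ _; set v := iter b _ _ => jP e.
apply: contrapT => uv.
pose k : int := if j == 1 then i else 1.
have kb : 0 <= k <= 2 by rewrite /k; case: ifP.
have uE : u = nbr k v.
  apply: nbr_uniq => // l lb lk.
  have [->|/eqP lj] := eqVneq l j; first exact: e.
  suff -> : l = 2 - i by rewrite !el_rot.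
  move: lk lj lb; rewrite /k; case: jP => ->; case: i02 => -> /=; lia.
have := par_rot t a; rewrite -/u uE parN // par_rot.
by case: (par t).
Qed.

Lemma incident_faces_el t j : 0 <= j <= 2 ->
  incident_faces (el t (2 - i)) j =
  [set el u j | u in [set u | el u (2 - i) = el t (2 - i)]].
Proof.
move=> jb; have ib' : -1 <= 2 - i <= 3 by case: i02 => ->.
have jb' : -1 <= j <= 3 by lia.
apply/seteqP; split=> [x [/= xj xc]|_ [u /= ut <-]].
  have [u [ux ut]] : exists u, el u (rank x) = x /\
      el u (rank (el t (2 - i))) = el t (2 - i).
    case/orP: xc => [/flag_through2|/flag_through2] [u [ux ut]];
      by exists u.
  by exists u => /=; [rewrite -{1}(rank_el t ib') | rewrite -xj].
split; first by rewrite /faces_of_rank /= rank_el.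
rewrite -ut; have [tu ru] := elP u ib'; have [tj rj] := elP u jb'.
by apply/orP; apply: (flag_setP u).1.
Qed.

Lemma rot_period_incident t j p : j = 1 \/ j = i -> (0 < p)%N ->
  (forall k, iter k (rot i) t = t <-> (p %| k)%N) ->
  incident_faces (el t (2 - i)) j #= `I_p.
Proof.
move=> jP p0 perP; have jb : 0 <= j <= 2 by case: jP => ->.
have pt : iter p (rot i) t = t by apply/perP.
have modp k : iter (k %% p) (rot i) t = iter k (rot i) t.
  rewrite [in RHS](divn_eq k p) addnC iterD.
  by congr iter; symmetry; apply/perP; rewrite dvdn_mull.
apply/card_eq_IP; exists (fun k : 'I_p => el (iter k (rot i) t) j).
  move=> a b /(rot_sep jP) e; apply: val_inj => /=.
  wlog ab : a b e / (a <= b)%N.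
    by move=> H; have [/H|/ltnW/H] := leqP a b; [exact | move=> <-].
  have : iter (b - a) (rot i) t = t.
    apply: (iter_inj (can_inj rotK) (a := a)).
    by rewrite subnK.
  move/perP; rewrite /dvdn modn_small.
    by rewrite subn_eq0 => ba; apply/eqP; rewrite eqn_leq ab.
  by apply: leq_ltn_trans (leq_subr _ _) (ltn_ord b).
rewrite incident_faces_el //; apply/seteqP; split=> [_ [u /= ut <-]|_ [k _ <-]].
  have [k [->|->]] := same_face_rot p0 pt ut.
    by exists (Ordinal (ltn_pmod k p0)); rewrite //= modp.
  case: jP => ->.
    exists (Ordinal (ltn_pmod k.+1 p0)); rewrite //= modp /= /rot el_nbr //.
    exact/nesym/i1.
  by exists (Ordinal (ltn_pmod k p0)); rewrite //= modp el_nbr.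
by exists (iter k (rot i) t) => //=; rewrite el_rot.
Qed.

(** Turns the type into a relation between flag exchanges. The edges met while rotating are among
    the m incident ones, so by the pigeonhole principle the rotation has a period at [t], and
    [rot_period_incident] identifies it with m. *)
Lemma incident_rot_period t m : incident_faces (el t (2 - i)) 1 #= `I_m ->
  (0 < m)%N /\ forall k, iter k (rot i) t = t <-> (m %| k)%N.
Proof.
move=> cm; have /card_eq_IP[g gI gE] := cm.
have ex k : exists l, g l = el (iter k (rot i) t) 1.
  have : incident_faces (el t (2 - i)) 1 (el (iter k (rot i) t) 1).
    rewrite incident_faces_el //; exists (iter k (rot i) t) => //=.
    exact: el_rot.
  by rewrite gE => -[l _ <-]; exists l.
have [h hE] := choice ex.
have [q q0 tq] : exists2 q, (0 < q)%N & iter q (rot i) t = t.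
  apply: contrapT => noq.
  have : injective (fun k : 'I_m.+1 => h k).
    move=> a b hab; have : el (iter a (rot i) t) 1 = el (iter b (rot i) t) 1.
      by rewrite -!hE hab.
    move/rot_sep => /(_ (or_introl erefl)) e; apply: val_inj => /=.
    wlog ab : a b e {hab} / (a <= b)%N.
      by move=> H; have [/H|/ltnW/H] := leqP a b; [exact | move=> <-].
    have := iter_inj (can_inj rotK) (a := a) (b := b - a) (x := t).
    rewrite subnK // => /(_ e) ba.
    apply/eqP; rewrite eqn_leq ab leqNgt; apply/negP => lt_ab.
    by apply: noq; exists (b - a)%N => //; rewrite subn_gt0.
  by move/leq_card; rewrite !card_ord ltnn.
have [p p0 perP] := iter_period (can_inj rotK) (ex_intro2 _ _ q q0 tq).
have cp := rot_period_incident (or_introl erefl) p0 perP.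
suff <- : p = m by [].
apply/card_eq_II; exact: card_eq_trans (card_esym cp) cm.
Qed.

End Rotations.

(** * Euler characteristic *)

Section Counting.
Variable P : polytope3.
Implicit Types (t u : flag_of P) (i j : int).

Lemma card_nbr_pair t i (Q : set (flag_of P)) : 0 <= i <= 2 ->
  Q t -> Q (nbr i t) ->
  (forall u, Q u -> forall j, 0 <= j <= 2 -> j <> i -> el u j = el t j) ->
  Q #= `I_2.
Proof.
move=> ib Qt Qnt Qel; suff -> : Q = [set t; nbr i t].
  by apply: card_set2; apply/nesym/nbr_neq.
apply/seteqP; split=> [u Qu|_ [->|->]] //.
have [ut|ut] := pselect (u = t); [by left | right].
by apply: nbr_uniq => //; apply: Qel.
Qed.

Lemma card_flags_face t i m : i = 0 \/ i = 2 ->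
  incident_faces (el t (2 - i)) 1 #= `I_m ->
  [set u | el u (2 - i) = el t (2 - i)] #= `I_(m * 2)%N.
Proof.
move=> i02; apply: (card_fibers (f := fun u => el u 1)).
  by move=> u ut; rewrite incident_faces_el //; exists u.
move=> y; rewrite incident_faces_el // => -[u ut uy].
apply: (@card_nbr_pair u i); first by case: i02 => ->.
- by split.
- by split; rewrite /= el_nbr //; case: i02 => ->.
- move=> v [vt vy] j jb ji; have [->|/eqP j1] := eqVneq j 1; first by rewrite vy.
  suff -> : j = 2 - i by rewrite vt ut.
  by case: i02 ji jb => -> *; lia.
Qed.

Lemma card_flags_edge t : [set u | el u 1 = el t 1] #= `I_4.
Proof.
apply: (card_fibers (b := 2) (k := 2) (f := fun u => el u 0)
  (B := [set x | rank x = 0 /\ (el t (-1) < x < el t 1)%O])).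
- move=> u ut; split; first exact: rank_el.
  by rewrite (el_outer t u) //= -ut !el_lt.
- move=> y [y0 /andP[ly yl]].
  have [//||u [uy ut]] := @el_change _ t 0 y _ y0 ly; first exact: yl.
  apply: (@card_nbr_pair u 2) => //; [by split; [apply: ut|] | |].
    by split; rewrite /= !el_nbr // ut.
  move=> v [vt vy] j jb j2; have [->|/eqP j1] := eqVneq j 1.
    by rewrite vt ut.
  suff -> : j = 0 by rewrite vy.
  by lia.
- by apply: diamond; rewrite ?rank_el //; apply: el_lt.
Qed.

Lemma card_flags N : chiral P -> has_order P N ->
  [set: flag_of P] #= `I_(2 * N)%N.
Proof.
move=> /chiral_parity[par [parN parP]] ordP.
apply: (card_fibers (f := par) (B := [set: bool])) => // [b _|]; last first.
  have -> : [set: bool] = [set true; false].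
    by apply/seteqP; split=> // -[] _; [left | right].
  exact: card_set2.
have [t0 _] := flag_through (bottom P).
have [t tb] : exists t, par t = b.
  case: (eqVneq (par t0) b) => [|tb]; first by exists t0.
  by exists (nbr 0 t0); rewrite parN //; case: (par t0) b tb => -[].
have -> : [set u | setT u /\ par u = b] = (fun f => img f t) @` @Aut P.
  apply/seteqP; split=> [u [_ ub]|_ [f Af <-]].
    have /parP[f Af fu] : par t = par u by rewrite ub.
    by exists f.
  by split=> //; rewrite -tb; symmetry; apply/parP; exists f.
apply: card_eq_trans ordP; apply: inj_card_eq => f g /set_mem Af /set_mem Ag.
exact: img_inj.
Qed.

Lemma card_faces_chiral N k1 k2 : (0 < k1)%N -> (0 < k2)%N ->
  chiral_of_order_type N k1 k2 P -> exists V E F : nat,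
  [/\ @faces_of_rank P 0 #= `I_V, @faces_of_rank P 1 #= `I_E,
      @faces_of_rank P 2 #= `I_F &
      [/\ N = V * k2, N = E * 2 & N = F * k1]%N].
Proof.
move=> k1p k2p [chP ordP [tyF tyV]]; have cT := card_flags chP ordP.
have base i k : 0 <= i <= 2 -> (0 < k)%N ->
    (forall t, [set u | el u i = el t i] #= `I_(k * 2)%N) ->
    exists2 b, @faces_of_rank P i #= `I_b & N = (b * k)%N.
  move=> ib k0 fib; have ib' : -1 <= i <= 3 by lia.
  have [|t _|y yi|b cb Nb] :=
    card_fibers_base (f := fun t => el t i) (B := @faces_of_rank P i)
      (k := (k * 2)%N) _ _ _ cT.
  - by rewrite muln_gt0 k0.
  - by rewrite /faces_of_rank /= rank_el.
  - have [t ty] := flag_through y.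
    have ti : el t i = y by rewrite -[in LHS](yi : rank y = i).
    have := fib t; rewrite ti; congr (_ #= _).
    by apply/seteqP; split=> u //= [].
  by exists b => //; lia.
have [V cV NV] : exists2 b, @faces_of_rank P 0 #= `I_b & N = (b * k2)%N.
  apply: base => // t; apply: (card_flags_face (i := 2)); first by right.
  by apply: (tyV _ _).1; apply: rank_el.
have [F cF NF] : exists2 b, @faces_of_rank P 2 #= `I_b & N = (b * k1)%N.
  apply: base => // t; apply: (card_flags_face (i := 0)); first by left.
  by apply: (tyF _ _).1; apply: rank_el.
have [E cE NE] : exists2 b, @faces_of_rank P 1 #= `I_b & N = (b * 2)%N.
  by apply: base => // t; apply: card_flags_edge.
by exists V, E, F.
Qed.

Lemma chiral_4_8_euler n : (10 <= n)%N ->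
  chiral_of_order_type (2 ^ n) 4 8 P ->
  euler_characteristic P (- (2 ^ (n - 3))%N%:Z) /\
  carrier_genus P (2 ^ (n - 4) + 1).
Proof.
move=> n10 /card_faces_chiral[//|//|V [E [F [cV cE cF [NV NE NF]]]]].
have n4 : (2 ^ n = 2 ^ (n - 4) * 16)%N.
  by rewrite -(expnD 2 _ 4); congr expn; lia.
have n3 : (2 ^ (n - 3) = 2 ^ (n - 4) * 2)%N.
  by rewrite -(expnD 2 _ 1); congr expn; lia.
(* In units of x = 2 ^ (n - 4): V = 2 x, E = 8 x and F = 4 x. *)
rewrite n4 in NV NE NF; rewrite /carrier_genus n3.
by split; exists V, E, F; split=> //; lia.
Qed.

End Counting.

(** * Type {4,4} *)

Section GaussianIdeals.

Lemma ideal_scale (I : int -> int -> Prop) (a b z : int) :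
  (forall a b c d, I a b -> I c d -> I (a + c) (b + d)) ->
  (forall a b, I a b -> I (- b) a) -> I a b -> I (z * a) (z * b).
Proof.
move=> ID IJ Iab.
have IN c d : I c d -> I (- c) (- d) by move/IJ/IJ.
have I0 : I 0 0 by have := ID _ _ _ _ Iab (IN _ _ Iab); rewrite !subrr.
have nat_scale (n : nat) : I (n%:Z * a) (n%:Z * b).
  elim: n => [|n IH]; first by rewrite !mul0r.
  by have := ID _ _ _ _ Iab IH; congr I; lia.
case: z => n //; have := IN _ _ (nat_scale n.+1).
by rewrite !NegzE !mulNr.
Qed.

(* An ideal of Z[i] containing a power of 2 is generated by a power of 1 + i,
   hence invariant under conjugation; exchanging the coordinates is conjugation
   followed by multiplication by i. *)
Lemma ideal_swap n (I : int -> int -> Prop) (a b : int) :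
  (forall a b c d, I a b -> I c d -> I (a + c) (b + d)) ->
  (forall a b, I a b -> I (- b) a) -> I (2 ^+ n) 0 ->
  I a b -> I b a.
Proof.
have [N] : exists N : nat, a * a + b * b <= N%:Z.
  by exists (absz (a * a + b * b)); nia.
elim: N I a b => [|N IH] I a b leN ID IJ I2 Iab.
  have a0 : a = 0 by nia.
  have b0 : b = 0 by nia.
  by move: Iab; rewrite a0 b0.
have [q [ab|ab]] : exists q : int, a + b = 2 * q \/ a + b = 2 * q + 1.
  by exists ((a + b) %/ 2)%Z; lia.
  have [e|ab0] := eqVneq (a * a + b * b) 0.
    have a0 : a = 0 by nia.
    have b0 : b = 0 by nia.
    by move: Iab; rewrite a0 b0.
  (* Even norm: a + b i = (1 + i) (q + d i). The quotients by 1 + i of the elements of [I] form an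
     ideal containing q + d i, which has half the norm, so the induction applies to that ideal. *)
  pose d := b - q.
  have Hc : a = q - d by lia.
  have Hd : b = q + d by lia.
  have J2 : I (q - d) (q + d) -> I (d - q) (d + q).
    apply: (IH (fun x y => I (x - y) (x + y))).
    + have e : a * a + b * b = 2 * (q * q + d * d) by rewrite {1 2}Hc Hd; nia.
      have q0 : 0 <= q * q by nia.
      have d0 : 0 <= d * d by nia.
      by move: ab0 leN; rewrite e; lia.
    + move=> x y z t Ixy Izt; have := ID _ _ _ _ Ixy Izt.
      by congr I; lia.
    + by move=> x y /IJ; congr I; lia.
    + by have := ID _ _ _ _ I2 (IJ _ _ I2); congr I; lia.
  (* The induction gives (-a, b), which three quarter-turns bring to (b, a). *)
  have := J2; rewrite -Hc -Hd => /(_ Iab)/IJ/IJ/IJ; congr I; lia.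
(* Odd norm: [I] contains the odd integer a^2 + b^2, where a + b = 2 q + 1, and with it and 2 ^ (m +
   1) also 2 ^ m; descending to 1, [I] is everything. *)
have I1 m : I (2 ^+ m) 0 -> I 1 0.
  elim: m => // m IHm; rewrite exprS => Im; apply: IHm.
  have Iq : I (2 * (2 * q * q + 2 * q - a * b) + 1) 0.
    have := ID _ _ _ _ (ideal_scale a ID IJ Iab)
      (ideal_scale (- b) ID IJ (IJ _ _ Iab)).
    by congr I; nia.
  have := ID _ _ _ _ (ideal_scale (2 ^+ m) ID IJ Iq)
    (ideal_scale (- (2 * q * q + 2 * q - a * b)) ID IJ Im).
  by congr I; rewrite ?mulr0 //; move: (2 ^+ m) => y; nia.
have {}I1 := I1 _ I2.
have := ID _ _ _ _ (ideal_scale b ID IJ I1) (ideal_scale a ID IJ (IJ _ _ I1)).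
by congr I; lia.
Qed.
End GaussianIdeals.

(** * The order of an automorphism divides the order of the group *)

Section AutomorphismOrder.

Lemma order_free_perm n (p : {perm 'I_n}) :
  (forall k i, (p ^+ k)%g i = i -> (p ^+ k)%g = 1%g) -> (#[p]%g %| n)%N.
Proof.
move=> free.
have co i : #|orbit 'P <[p]>%g i| = #[p]%g.
  rewrite /orbit card_in_imset //= => _ _ /cycleP[k ->] /cycleP[l ->].
  wlog kl : k l / (k <= l)%N.
    by move=> H; have [/H|/ltnW/H H' /esym/H'/esym] := leqP k l.
  rewrite !apermE => e; have : (p ^+ (l - k))%g (((p ^+ k))%g i) = (p ^+ k)%g i.
    by rewrite -permM -expgD subnKC.
  by move/free => e1; rewrite -(subnK kl) expgD e1 mul1g.
have uni : {in orbit 'P <[p]>%g @: finset.setTfor 'I_n,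
    forall A : {set 'I_n}, #|A| = #[p]%g} by move=> _ /imsetP[i _ ->].
rewrite -[n in X in (_ %| X)%N]card_ord -cardsT (card_uniform_partition uni).
  by rewrite dvdn_mull.
by apply: orbit_partition; apply/actsP => g _ i; rewrite !inE.
Qed.

(** Lagrange's theorem: composition with [f] permutes the N automorphisms, and a power of this
    permutation with a fixed point is trivial, so all its cycles have the same length. *)
Lemma iter_Aut (P : polytope3) N f : has_order P N -> @Aut P f ->
  iter N f = id.
Proof.
move=> /card_eq_IP[g gI gE] Af.
have gA i : Aut (g i) by rewrite gE; exists i.
have ex i : exists j, g j = f \o g i.
  have : Aut (f \o g i) by apply: Aut_comp.
  by rewrite gE => -[j _ <-]; exists j.
have [h hE] := choice ex.
have [f' [fK f'K _ _]] := Af.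
have hI : injective h.
  move=> i j hij; apply: gI; apply: funext => x.
  have := congr1 (fun k => k x) (hE i); rewrite hij hE /=.
  by move/(can_inj fK).
pose p := perm hI.
have pE k i : g ((p ^+ k)%g i) = iter k f \o g i.
  elim: k => [|k IH]; first by rewrite expg0 perm1.
  by rewrite expgSr permM permE hE IH.
have free k i : (p ^+ k)%g i = i -> (p ^+ k)%g = 1%g.
  move=> pk; apply/permP => j; rewrite perm1; apply: gI; rewrite pE.
  have fk : iter k f = id.
    have [g' [_ g'K _ _]] := gA i.
    apply: funext => x; rewrite -[in LHS](g'K x).
    have := congr1 (fun h => h (g' x)) (pE k i).
    by rewrite pk /= g'K => <-.
  by rewrite fk.
have /dvdnP[m Nm] := order_free_perm free.
have [i _ gi] : range g id by rewrite -gE; apply: Aut_id.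
have pN : (p ^+ N)%g = 1%g.
  suff -> : (p ^+ N)%g = (p ^+ (#[p]%g * m))%g by rewrite expgM expg_order expg1n.
  by congr (_ ^+ _)%g; rewrite mulnC.
have := pE N i; rewrite pN perm1 gi => e.
by apply: funext => x; have := congr1 (fun h => h x) e.
Qed.

End AutomorphismOrder.

(** * Integer powers of a bijection *)

Section IntegerIteration.
Variables (T : Type) (h h' : T -> T).

Definition ziter (z : int) t :=
  match z with Posz n => iter n h t | Negz n => iter n.+1 h' t end.

Hypotheses (hK : cancel h h') (h'K : cancel h' h).

Lemma ziterS z t : ziter (z + 1) t = h (ziter z t).
Proof.
case: z => [n|[|n]].
- by rewrite (_ : Posz n + 1 = Posz n.+1) //; lia.
- by rewrite (_ : Negz 0 + 1 = Posz 0) //= h'K.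
- by rewrite (_ : Negz n.+1 + 1 = Negz n) ?[in RHS]/= ?h'K //; lia.
Qed.

Lemma ziterP z t : ziter (z - 1) t = h' (ziter z t).
Proof. by rewrite -[in RHS](subrK 1 z) ziterS hK. Qed.

Lemma ziterD m n t : ziter (m + n) t = ziter m (ziter n t).
Proof.
elim/int_rec: m => [|k IH|k IH]; first by rewrite add0r.
- rewrite (_ : k.+1%:Z + n = (k%:Z + n) + 1) ?ziterS ?IH; last lia.
  by rewrite (_ : k.+1%:Z = k%:Z + 1) ?ziterS //; lia.
- rewrite (_ : - k.+1%:Z + n = (- k%:Z + n) - 1) ?ziterP ?IH; last lia.
  by rewrite (_ : - k.+1%:Z = - k%:Z - 1) ?ziterP //; lia.
Qed.

End IntegerIteration.

Lemma ziter_morph T (f g g' h h' : T -> T) z t :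
  (forall t, f (g t) = h (f t)) -> (forall t, f (g' t) = h' (f t)) ->
  f (ziter g g' z t) = ziter h h' z (f t).
Proof.
move=> fg fg'; case: z => n /=; last rewrite fg'; first by elim: n => //= n <-.
by congr h'; elim: n => //= n <-.
Qed.

Lemma ziter_opp T (h h' : T -> T) z t : ziter h' h z t = ziter h h' (- z) t.
Proof.
case: z => [[|n]|n]; rewrite ?oppr0 //.

Qed.

(** * The group of the square tessellation acting on flags *)

Section SquareTessellation.
Variables (T : Type) (a b c : T -> T).
Hypotheses (aK : involutive a) (bK : involutive b) (cK : involutive c).
Hypothesis acC : forall t, a (c t) = c (a t).
Hypothesis baba : forall t, b (a (b (a t))) = a (b (a (b t))).
Hypothesis cbcb : forall t, c (b (c (b t))) = b (c (b (c t))).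
Implicit Types (t u s : T) (m k p q : int).

(* [A] is a rotation about a face, [X] and [Y] are the unit translations of
   the square tessellation. *)
Definition rotA t := a (b t).
Definition trX t := a (b (c (b t))).
Definition trX' t := b (c (b (a t))).
Definition trY t := b (a (b (c t))).
Definition trY' t := c (b (a (b t))).

Local Notation A := rotA.
Local Notation X := trX.
Local Notation X' := trX'.
Local Notation Y := trY.
Local Notation Y' := trY'.

Let XK : cancel X X'. Proof. by move=> t; rewrite /trX /trX' !(aK, bK, cK). Qed.
Let X'K : cancel X' X. Proof. by move=> t; rewrite /trX /trX' !(aK, bK, cK). Qed.
Let YK : cancel Y Y'. Proof. by move=> t; rewrite /trY /trY' !(aK, bK, cK). Qed.
Let Y'K : cancel Y' Y. Proof. by move=> t; rewrite /trY /trY' !(aK, bK, cK). Qed.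

Let bX t : b (X t) = Y (b t). Proof. by []. Qed.
Let bX' t : b (X' t) = Y' (b t). Proof. by rewrite /trX' /trY' !bK. Qed.
Let bY t : b (Y t) = X (b t). Proof. by rewrite /trX /trY !bK. Qed.
Let bY' t : b (Y' t) = X' (b t). Proof. by []. Qed.

Let AX t : A (X t) = Y (A t).
Proof. by rewrite /rotA /trX /trY -baba acC. Qed.

Let AX' t : A (X' t) = Y' (A t).
Proof. by apply: (can_inj YK); rewrite -AX X'K Y'K. Qed.

Let AY t : A (Y t) = X' (A t).
Proof. by rewrite /rotA /trY /trX' !(aK, bK). Qed.

Let AY' t : A (Y' t) = X (A t).
Proof. by apply: (can_inj X'K); rewrite -AY. Qed.

Let XY t : X (Y t) = Y (X t).
Proof.
by rewrite /trX /trY bK -!acC baba cbcb bK.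
Qed.

Definition trans m k t := ziter X X' m (ziter Y Y' k t).

Lemma transD m k p q t : trans m k (trans p q t) = trans (m + p) (k + q) t.
Proof.
have X'Y s : X' (Y s) = Y (X' s) by apply: (can_inj XK); rewrite X'K XY X'K.
have XY' s : X (Y' s) = Y' (X s) by apply: (can_inj YK); rewrite -XY !Y'K.
have X'Y' s : X' (Y' s) = Y' (X' s) by apply: (can_inj XK); rewrite X'K XY' X'K.
rewrite /trans !ziterD //; congr (ziter _ _ m _).
symmetry; apply: ziter_morph => s; symmetry; apply: ziter_morph => {}s.
- exact/esym/XY.
- exact/esym/X'Y.
- exact/esym/XY'.
- exact/esym/X'Y'.
Qed.

Lemma trans0 t : trans 0 0 t = t. Proof. by []. Qed.

Lemma b_trans m k t : b (trans m k t) = trans k m (b t).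
Proof.
have -> : b (trans m k t) = ziter Y Y' m (ziter X X' k (b t)).
  by rewrite /trans (ziter_morph (h := Y) (h' := Y')) //;
    rewrite (ziter_morph (h := X) (h' := X')).
by have e := transD 0 m k 0 (b t); rewrite add0r addr0 in e.
Qed.

(** With [trans m k] read as translation by m + k i, conjugation by [A] is multiplication by i, and
    conjugation by [b] exchanges the coordinates. *)
Lemma A_trans m k t : A (trans m k t) = trans (- k) m (A t).
Proof.
have -> : A (trans m k t) = ziter Y Y' m (ziter X' X k (A t)).
  by rewrite /trans (ziter_morph (h := Y) (h' := Y')) //;
    rewrite (ziter_morph (h := X') (h' := X)).
rewrite (ziter_opp X X').
by have e := transD 0 m (- k) 0 (A t); rewrite add0r addr0 in e.
Qed.

Lemma iter_rotA_trans (j : nat) m k : exists m' k',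
  forall s, iter j A (trans m k s) = trans m' k' (iter j A s).
Proof.
elim: j => [|j [m' [k' IH]]]; first by exists m, k.
by exists (- k'), m' => s; rewrite /= IH A_trans.
Qed.

Lemma rotA4 t : iter 4 A t = t.
Proof. by rewrite /= /rotA -[X in a (b X)]baba !(aK, bK). Qed.

Lemma b_rotA j t : b (iter j A t) = iter (3 * j) A (b t).
Proof.
have A1 s : b (A s) = iter 3 A (b s).
  by rewrite -[in LHS](bK s) -[in LHS](rotA4 (b s)) /= /rotA !(aK, bK).
by elim: j => // j IH; rewrite iterS A1 IH mulnS -iterD.
Qed.

(* [b], [a = A b] and [c = A^-1 X b] generate the group of the tessellation,
   and the translations are normalised by [A] and [b]. *)
Definition square_normal (f : T -> T) := exists m k j e, forall t,
  f t = trans m k (iter j A (if e then b t else t)).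

Lemma square_normal_b f : square_normal f -> square_normal (b \o f).
Proof.
move=> [m [k [j [e fE]]]]; exists k, m, (3 * j)%N, (~~ e) => t /=.
by rewrite fE b_trans b_rotA; case: e {fE} => //=; rewrite bK.
Qed.

Lemma square_normal_A f : square_normal f -> square_normal (A \o f).
Proof.
move=> [m [k [j [e fE]]]]; exists (- k), m, j.+1, e => t /=.
by rewrite fE A_trans.
Qed.

Lemma square_normal_X f : square_normal f -> square_normal (X \o f).
Proof.
move=> [m [k [j [e fE]]]]; exists (1 + m), k, j, e => t /=.
by have e1 := transD 1 0 m k (iter j A (if e then b t else t));
  rewrite add0r in e1; rewrite fE -e1.
Qed.

Lemma eq_square_normal f g : f =1 g -> square_normal f -> square_normal g.
Proof. by move=> fg; rewrite (_ : f = g) //; apply/funext. Qed.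

Lemma square_normal_a f : square_normal f -> square_normal (a \o f).
Proof.
move=> /square_normal_b/square_normal_A; apply: eq_square_normal => t /=.
by rewrite /rotA bK.
Qed.

Lemma square_normal_c f : square_normal f -> square_normal (c \o f).
Proof.
move=> /square_normal_b/square_normal_X/square_normal_a/square_normal_b.
by apply: eq_square_normal => t /=; rewrite /trX !(aK, bK).
Qed.

Hypothesis aba_neq : forall t, a (b (a (b t))) <> t.
Hypothesis cbcb_neq : forall t, c (b (c (b t))) <> t.
Hypothesis ac_neq : forall t, a t <> c t.

(* Conjugating by a translation changes the coefficients of a half-turn by even
   integers, so it fixes a flag only if one about a vertex, an edge or a face
   does. *)
Lemma half_turn_neq m k t : trans m k (A (A t)) <> t.
Proof.
have XA s : X (A (A s)) <> s.
  have XE u : X u = a (b (c (b u))) by [].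
  rewrite /rotA -baba XE bK => e; apply: (ac_neq (t := b (a s))).
  have e2 := congr1 (fun x => b (a x)) e; rewrite /= aK bK in e2.
  by rewrite -[in RHS]e2 cK.
have YA s : Y (A (A s)) <> s.
  move=> e; apply: (XA (iter 3 A s)).
  have AK : cancel A (fun t => b (a t)) by move=> u; rewrite /rotA aK bK.
  by apply: (can_inj AK); rewrite AX -[A (iter 3 A s)]/(iter 4 A s) rotA4.
have XYA s : X (Y (A (A s))) <> s.
  have XYE u : X (Y u) = a (b (c (a (b (c u))))).
    by rewrite -[X _]/(a (b (c (b (b (a (b (c u)))))))) bK.
  rewrite XYE /rotA -baba => e.
  apply: (cbcb_neq (t := a (b (a s)))).
  have e2 := congr1 (fun x => a (b (a x))) e; rewrite /= aK bK in e2.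
  by rewrite -[in RHS]e2 acC aK.
have [p [m' [m01 mE]]] : exists p m', (m' = 0 \/ m' = 1) /\ m = p + p + m'.
  by exists (m %/ 2)%Z, (m %% 2)%Z; lia.
have [q [k' [k01 kE]]] : exists q k', (k' = 0 \/ k' = 1) /\ k = q + q + k'.
  by exists (k %/ 2)%Z, (k %% 2)%Z; lia.
pose s := trans (- p) (- q) t.
have ts : t = trans p q s by rewrite transD !subrr.
clearbody s; rewrite ts !A_trans transD => e.
have {e} : trans m' k' (A (A s)) = s.
  have := congr1 (trans (- p) (- q)) e; rewrite !transD !addNr trans0 => e'.
  by rewrite -[RHS]e'; congr trans; lia.
case: m01 k01 => -> [] ->.
- exact: aba_neq.
- exact: YA.
- exact: XA.
- exact: XYA.
Qed.

Variable (par : T -> bool) (n : nat).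
Hypothesis par_a : forall t, par (a t) = ~~ par t.
Hypothesis par_b : forall t, par (b t) = ~~ par t.
Hypothesis par_c : forall t, par (c t) = ~~ par t.
Hypothesis par_hom : forall t u, par t = par u -> exists2 f : T -> T, f t = u &
  forall s, [/\ f (a s) = a (f s), f (b s) = b (f s) & f (c s) = c (f s)].
Hypothesis X_period : forall t, iter (2 ^ n) X t = t.

Let par_iter h j t : (forall s, par (h s) = par s) -> par (iter j h t) = par t.
Proof. by move=> ph; elim: j => //= j <-. Qed.

Let par_A t : par (A t) = par t.
Proof. by rewrite /rotA !(par_a, par_b) negbK. Qed.

Let par_trans m k t : par (trans m k t) = par t.
Proof.
have parz (h h' : T -> T) z s : (forall s, par (h s) = par s) ->
    (forall s, par (h' s) = par s) -> par (ziter h h' z s) = par s.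
  by case: z => z ph ph'; apply: par_iter.
by rewrite /trans !parz // => s; rewrite !(par_a, par_b, par_c) !negbK.
Qed.

(** The flag [iter 3 A t], which is A^-1 t, has the parity of [t], so a map commuting with all words
    carries [t] to it and the same translations fix both. Conjugating by [A] returns to [t] and
    rotates the translation. *)
Lemma trans_rot m k t : trans m k t = t -> trans (- k) m t = t.
Proof.
move=> mkt; have [|f ft fC] := @par_hom t (iter 3 A t).
  by rewrite par_iter.
have fa s : f (a s) = a (f s) by case: (fC s).
have fb s : f (b s) = b (f s) by case: (fC s).
have fc s : f (c s) = c (f s) by case: (fC s).
have mku : trans m k (iter 3 A t) = iter 3 A t.
  rewrite -ft -[in RHS]mkt /trans.
  rewrite (ziter_morph (f := f) (h := X) (h' := X'))
    ?(ziter_morph (f := f) (h := Y) (h' := Y')) //.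
  - by move=> s; rewrite /trY !(fa, fb, fc).
  - by move=> s; rewrite /trY' !(fa, fb, fc).
  - by move=> s; rewrite /trX !(fa, fb, fc).
  - by move=> s; rewrite /trX' !(fa, fb, fc).
by have := congr1 A mku; rewrite A_trans -[A (iter 3 A t)]/(iter 4 A t) rotA4.
Qed.

Lemma trans_swap m k t : trans m k t = t -> trans k m t = t.
Proof.
apply: (ideal_swap (n := n) (I := fun m k => trans m k t = t)).
- by move=> p q p' q' pq pq'; rewrite -transD pq' pq.
- by move=> p q; apply: trans_rot.
- rewrite (_ : 2 ^+ n = Posz (2 ^ n)); first exact: X_period.
  by elim: n => // k' IH; rewrite exprS expnS IH PoszM.
Qed.

(** The square of a quarter-turn is a half-turn, so [half_turn_neq] excludes both. *)
Lemma rotA_fix m k j t : trans m k (iter j A t) = t -> (4 %| j)%N.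
Proof.
have mod4 i : iter i A t = iter (i %% 4) A t.
  rewrite {1}(divn_eq i 4) addnC iterD; congr iter.
  by elim: (i %/ 4)%N => // l IH; rewrite mulSn iterD IH rotA4.
have twist p q i : (i %% 4 = 2)%N -> trans p q (iter i A t) <> t.
  by rewrite mod4 => ->; apply: half_turn_neq.
move=> e; apply: contraT => j4.
have [j2|j2] := eqVneq (j %% 4)%N 2%N; first by case: (twist m k _ j2).
have [m' [k' mk]] := iter_rotA_trans j m k.
have jj : ((j + j) %% 4 = 2)%N by move: j4 j2; lia.
case: (twist (m + m') (k + k') _ jj).
by rewrite -transD iterD -mk !e.
Qed.

(** Parity excludes the factor [b] and [rotA_fix] the rotation, so [f] is a translation. At [b t] it
    acts as the translation with exchanged coordinates does at [t], and [trans_swap] applies. *)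
Lemma square_normal_fix f t : square_normal f -> f t = t -> f (b t) = b t.
Proof.
move=> [m [k [j [[] fE]]]]; rewrite !fE => e.
  have : par t = ~~ par t by rewrite -{1}e par_trans par_iter // par_b.
  by case: (par t).
have /dvdnP[l jE] := rotA_fix e.
have j4 s : iter j A s = s.
  by rewrite jE; elim: l {jE} => // l IH; rewrite mulSn iterD IH rotA4.
rewrite j4 in e; rewrite j4; apply: (can_inj bK).
by rewrite b_trans bK (trans_swap e).
Qed.

End SquareTessellation.

(* The map sending the image of [t] under a word to the image of [nbr i t] under
   the same word is well defined and involutive. *)
Lemma nbr_stable_Aut (P : polytope3) (t : flag_of P) (i : int) : 0 <= i <= 2 ->
  (forall w, all (fun j : int => 0 <= j <= 2) w -> foldr (@nbr P) t w = t ->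
    foldr (@nbr P) (nbr i t) w = nbr i t) ->
  exists2 f, Aut f & img f t = nbr i t.
Proof.
move=> ib stab.
have actK w s : all (fun j : int => 0 <= j <= 2) w ->
    foldr (@nbr P) (foldr (@nbr P) s w) (rev w) = s.
  elim: w s => // j w IH s /= /andP[jb ww].
  by rewrite rev_cons -cats1 foldr_cat /= nbrK // IH.
have stab2 v w : all (fun j : int => 0 <= j <= 2) v ->
    all (fun j : int => 0 <= j <= 2) w ->
    foldr (@nbr P) t v = foldr (@nbr P) t w ->
    foldr (@nbr P) (nbr i t) v = foldr (@nbr P) (nbr i t) w.
  move=> vv ww e.
  have := stab (rev v ++ w); rewrite all_cat all_rev vv ww foldr_cat -e actK //.
  move=> /(_ isT erefl); rewrite foldr_cat => e2.
  rewrite -[in LHS]e2; have := actK (rev v) (foldr (@nbr P) (nbr i t) w).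
  by rewrite all_rev revK; apply.
have word u : exists w, all (fun j : int => 0 <= j <= 2) w /\
    u = foldr (@nbr P) t w.
  by have [w ww uw] := flags_reach t u; exists w.
have [wd wdP] := choice word.
pose th u := foldr (@nbr P) (nbr i t) (wd u).
have thE w : all (fun j : int => 0 <= j <= 2) w ->
    th (foldr (@nbr P) t w) = foldr (@nbr P) (nbr i t) w.
  move=> ww; apply: stab2 => //; first exact: (wdP _).1.
  by rewrite -(wdP _).2.
have thN j u : 0 <= j <= 2 -> th (nbr j u) = nbr j (th u).
  move=> jb; have [wu uE] := wdP u.
  by rewrite {1}uE -[nbr j _]/(foldr (@nbr P) t (j :: wd u)) thE //= jb.
have tht : th t = nbr i t by exact: (thE [::]).
have thK : involutive th.
  move=> u; have [wu uE] := wdP u; rewrite uE.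
  elim: (wd u) wu {uE} => [_|j w IH /= /andP[jb /IH e]]; last by rewrite !thN // e.
  by rewrite /= tht thN // tht nbrK.
have [f Af fE] := flag_map_Aut thK thK thN.
by exists f; rewrite ?fE.
Qed.

Lemma no_chiral_4_4 (P : polytope3) n : ~ chiral_of_order_type (2 ^ n) 4 4 P.
Proof.
move=> [/chiral_parity[par [parN parP]] ordP [typF typV]].
have [a aE] : {a | a = @nbr P 0} by eexists.
have [b bE] : {b | b = @nbr P 1} by eexists.
have [c cE] : {c | c = @nbr P 2} by eexists.
have aK : involutive a by rewrite (aE, bE, cE); exact: nbrK.
have bK : involutive b by rewrite (aE, bE, cE); exact: nbrK.
have cK : involutive c by rewrite (aE, bE, cE); exact: nbrK.
have rot4 (i : int) (t : flag_of P) : i = 0 \/ i = 2 ->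
    forall k : nat, iter k (rot i) t = t <-> (4 %| k)%N.
  move=> i02; suff inc : incident_faces (el t (2 - i)) 1 #= `I_4.
    exact: (incident_rot_period parN i02 inc).2.
  by case: i02 => ->; [apply: (typF _ _).1 | apply: (typV _ _).1];
    apply: rank_el.
have aba4 t : a (b (a (b (a (b (a (b t))))))) = t.
  by rewrite aE bE; apply: (rot4 0 t (or_introl erefl) 4%N).2.
have cbc4 t : c (b (c (b (c (b (c (b t))))))) = t.
  by rewrite cE bE; apply: (rot4 2 t (or_intror erefl) 4%N).2.
have baba t : b (a (b (a t))) = a (b (a (b t))).
  by rewrite -[in LHS](aba4 t) !(aK, bK).
have cbcb t : c (b (c (b t))) = b (c (b (c t))).
  by rewrite -[in RHS](cbc4 t) !(cK, bK).
have acC t : a (c t) = c (a t) by rewrite aE cE nbr_comm02.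
have aba2 t : a (b (a (b t))) <> t.
  by rewrite aE bE; move/(rot4 0 t (or_introl erefl) 2%N).1.
have cbc2 t : c (b (c (b t))) <> t.
  by rewrite cE bE; move/(rot4 2 t (or_intror erefl) 2%N).1.
have ac_neq t : a t <> c t.
  by rewrite aE cE => e; apply: (@el_nbr_neq _ 0 t isT); rewrite e el_nbr.
have par_a t : par (a t) = ~~ par t by rewrite aE parN.
have par_b t : par (b t) = ~~ par t by rewrite bE parN.
have par_c t : par (c t) = ~~ par t by rewrite cE parN.
have hom f : Aut f ->
    forall s, [/\ img f (a s) = a (img f s), img f (b s) = b (img f s) &
                   img f (c s) = c (img f s)].
  by move=> Af s; rewrite aE bE cE !img_nbr.
have par_hom t u : par t = par u -> exists2 f, f t = u &
    forall s, [/\ f (a s) = a (f s), f (b s) = b (f s) & f (c s) = c (f s)].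
  by move=> /parP[f Af fu]; exists (img f) => //; apply: hom.
(* The word [trX] is even, so at [t] it agrees with an automorphism f; since words commute with
   automorphisms, its powers at [t] agree with those of f. *)
have X_period t : iter (2 ^ n) (trX a b c) t = t.
  have /parP[f Af fX] : par t = par (trX a b c t).
    by rewrite /trX !(par_a, par_b, par_c) !negbK.
  have iterX k : Aut (iter k f) /\ iter k (trX a b c) t = img (iter k f) t.
    elim: k => [|k [Ak IH]]; first by split; [exact: Aut_id | rewrite img_id].
    split; first exact: Aut_comp.
    have XC g s : Aut g -> trX a b c (img g s) = img g (trX a b c s).
      move=> Ag; rewrite /trX; case: (hom g Ag (b (c (b s)))) => -> _ _.
      case: (hom g Ag (c (b s))) => _ -> _; case: (hom g Ag (b s)) => _ _ ->.
      by case: (hom g Ag s) => _ -> _.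
    rewrite iterS IH XC // -fX -img_comp //; congr (img _ t).
    by apply/funext => x; rewrite /= -iterS iterSr.
  by rewrite (iterX _).2 (iter_Aut ordP Af) img_id.
have normal w : all (fun i : int => 0 <= i <= 2) w ->
    square_normal a b c (fun t => foldr (@nbr P) t w).
  elim: w => [_|i w IH /andP[ib /IH nw]].
    by exists 0, 0, 0%N, false.
  have [->|[->|->]] : i = 0 \/ i = 1 \/ i = 2 by lia.
  - by have := square_normal_a aK bK cK acC baba cbcb nw; rewrite aE.
  - by have := square_normal_b aK bK cK acC baba cbcb nw; rewrite bE.
  - by have := square_normal_c aK bK cK acC baba cbcb nw; rewrite cE.
have [t _] := flag_through (bottom P).
suff [f Af ft] : exists2 f, Aut f & img f t = nbr 1 t.
  have : par t = par (nbr 1 t) by apply/parP; exists f.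
  by rewrite parN //; case: (par t).
apply: nbr_stable_Aut => // w ww wt; rewrite -bE.
apply: (square_normal_fix aK bK cK acC baba cbcb aba2 cbc2 ac_neq
  par_a par_b par_c par_hom X_period (normal w ww)).
exact: wt.
Qed.

(** * Polytopes from systems of flags *)

(* The flags of a polytope given abstractly, with [lab i x] a name for the face
   of rank i of the flag x; names of faces of ranks -1 and 3 carry nothing. *)
Record flag_system := FlagSystem {
  sys_flag : Type;
  sys_label : choiceType;
  lab : int -> sys_flag -> sys_label;
  swap : int -> sys_flag -> sys_flag;
  sys_base : sys_flag;
  lab_outer : forall i x y, ~~ (0 <= i <= 2) -> lab i x = lab i y;
  lab_inj : forall x y, (forall i, 0 <= i <= 2 -> lab i x = lab i y) -> x = y;
  lab_swap : forall i j x, 0 <= i <= 2 -> j <> i -> lab j (swap i x) = lab j x;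
  lab_swap_neq : forall i x, 0 <= i <= 2 -> lab i (swap i x) <> lab i x;
  lab_diamond : forall i x y, 0 <= i <= 2 ->
    lab (i - 1) y = lab (i - 1) x -> lab (i + 1) y = lab (i + 1) x ->
    lab i y = lab i x \/ lab i y = lab i (swap i x);
  sys_connected : forall x y, exists2 w : seq int,
    (forall i, i \in w -> 0 <= i <= 2 /\ lab i x <> lab i y) &
    y = foldr swap x w
}.

(** * The poset of faces of a flag system *)

Section SystemFaces.
Variable S : flag_system.
Local Notation lab := (@lab S).
Local Notation swap := (@swap S).

Definition sys_face := {p : int * sys_label S |
  `[< -1 <= p.1 <= 3 /\ exists x, lab p.1 x = p.2 >]}.

HB.instance Definition _ := Choice.on sys_face.

Implicit Types (p q : sys_face) (x y z : sys_flag S) (i j k : int).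

Definition sys_rank p : int := (val p).1.

Definition of_flag x p := (val p).2 = lab (sys_rank p) x.

Definition sys_le p q := (p == q) ||
  `[< sys_rank p < sys_rank q /\ exists x, of_flag x p /\ of_flag x q >].

Lemma sys_rank_bounds p : -1 <= sys_rank p <= 3.
Proof. by case: (asboolW (valP p)). Qed.

Lemma of_some_flag p : exists x, of_flag x p.
Proof. by case: p => p /= Hp; have [_ [x xp]] := asboolW Hp; exists x. Qed.

Lemma of_flag_inj x p q : of_flag x p -> of_flag x q ->
  sys_rank p = sys_rank q -> p = q.
Proof.
rewrite /of_flag /sys_rank => xp xq pq; apply: val_inj.
by rewrite [LHS]surjective_pairing [RHS]surjective_pairing xp xq pq.
Qed.

Lemma sys_face_of x i : -1 <= i <= 3 -> exists2 p, of_flag x p & sys_rank p = i.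
Proof.
move=> ib; have H : `[< -1 <= i <= 3 /\ exists y, lab i y = lab i x >].
  by apply/asboolP; split=> //; exists x.
by exists (exist _ (i, lab i x) H).
Qed.

(** Only the ranks 0, 1, 2 are in question. An edge lies on just two 2-faces, so [x] or [swap 2 x]
    has the 2-face of [y]. Transitivity of incidence follows. *)
Lemma lab_exchange i j k x y : i < j -> j < k -> lab j x = lab j y ->
  exists z, [/\ lab i z = lab i x, lab j z = lab j x & lab k z = lab k y].
Proof.
move=> ij jk xy; have [ib|ib] := boolP (0 <= i <= 2); last first.
  by exists y; split=> //; apply: lab_outer.
have [kb|kb] := boolP (0 <= k <= 2); last first.
  by exists x; split=> //; apply: lab_outer.
have [i0 [j1 k2]] : i = 0 /\ j = 1 /\ k = 2 by lia.
move: xy; rewrite {ij jk ib kb}i0 {}j1 {}k2 => xy.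
have [| |yx|yx] := @lab_diamond S 2 x y isT.
- by rewrite xy.
- exact: lab_outer.
- by exists x; rewrite yx.
- by exists (swap 2 x); split; [apply: lab_swap | apply: lab_swap | rewrite yx].
Qed.

Lemma sys_le_refl : reflexive sys_le. Proof. by move=> p; rewrite /sys_le eqxx. Qed.

Lemma sys_le_anti : antisymmetric sys_le.
Proof.
move=> p q; rewrite /sys_le => /andP[/orP[/eqP//|/asboolP[pq _]]].
case/orP=> [/eqP->//|/asboolP[qp _]]; move: pq qp; lia.
Qed.

Lemma sys_le_trans : transitive sys_le.
Proof.
move=> q p s; rewrite /sys_le => /orP[/eqP->//|/asboolP[pq [x [xp xq]]]].
case/orP=> [/eqP<-|/asboolP[qs [y [yq ys]]]]; apply/orP; right; apply/asboolP.
  by split=> //; exists x.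
split; first by move: pq qs; lia.
have [|z [zi zj zk]] := lab_exchange pq qs (x := x) (y := y).
  by rewrite -xq.
by exists z; rewrite /of_flag zi zk.
Qed.

HB.instance Definition _ := @Order.Le_isPOrder.Build (Order.Disp tt tt) sys_face
  sys_le sys_le_refl sys_le_anti sys_le_trans.

Lemma sys_leE p q : (p <= q)%O = sys_le p q. Proof. by []. Qed.

Lemma sys_ltP p q : (p < q)%O ->
  sys_rank p < sys_rank q /\ exists x, of_flag x p /\ of_flag x q.
Proof. by rewrite lt_neqAle sys_leE => /andP[/negPf pq]; rewrite /sys_le pq => /asboolP. Qed.

Lemma sys_lt x p q : of_flag x p -> of_flag x q -> sys_rank p < sys_rank q ->
  (p < q)%O.
Proof.
move=> xp xq pq; rewrite lt_neqAle sys_leE; apply/andP; split.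
  by apply: contraTneq pq => ->; rewrite ltxx.
by apply/orP; right; apply/asboolP; split=> //; exists x.
Qed.

Lemma sys_le_of x p q : of_flag x p -> of_flag x q -> sys_rank p <= sys_rank q ->
  (p <= q)%O.
Proof.
move=> xp xq; rewrite (le_eqVlt (sys_rank p)) => /orP[/eqP pq|pq].
  by rewrite (of_flag_inj xp xq pq).
exact/ltW/(sys_lt xp xq).
Qed.

Lemma of_flag_total x :
  total_on [set p | of_flag x p] (fun p q => (p <= q)%O).
Proof.
move=> p q xp xq; have [pq|qp] := leP (sys_rank p) (sys_rank q); [left|right].
  exact: sys_le_of xp xq pq.
exact: sys_le_of xq xp (ltW qp).
Qed.

Lemma comparable_of_flag p q : (p <= q)%O \/ (q <= p)%O ->
  exists x, of_flag x p /\ of_flag x q.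
Proof.
have H a b : (a <= b)%O -> exists x, of_flag x a /\ of_flag x b.
  rewrite le_eqVlt => /orP[/eqP->|/sys_ltP[_ //]].
  by have [x xb] := of_some_flag b; exists x.
by case=> /H // [x []]; exists x.
Qed.

Lemma comparable_same_rank p q : (p <= q)%O \/ (q <= p)%O ->
  sys_rank p = sys_rank q -> p = q.
Proof. by case/comparable_of_flag=> x []; apply: of_flag_inj. Qed.

(** If the chain has an edge, a flag through its faces of ranks 0, 1 and one through those of ranks
    1, 2 are merged at the edge by [lab_exchange]; otherwise one flag through at most two proper
    faces suffices. *)
Lemma chain_of_flag (C : set sys_face) : total_on C (fun p q => (p <= q)%O) ->
  exists x, C `<=` [set p | of_flag x p].
Proof.
move=> totC.
have pair i j : exists x, (forall p, C p -> sys_rank p = i -> of_flag x p) /\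
    (forall p, C p -> sys_rank p = j -> of_flag x p).
  have uniq p q : C p -> C q -> sys_rank p = sys_rank q -> p = q.
    by move=> Cp Cq; apply: comparable_same_rank; apply: totC.
  have [[p [Cp pi]]|noi] := pselect (exists p, C p /\ sys_rank p = i).
    have [[q [Cq qj]]|noj] := pselect (exists q, C q /\ sys_rank q = j).
      have [x [xp xq]] := comparable_of_flag (totC p q Cp Cq).
      by exists x; split=> s Cs sr; [rewrite (uniq s p) // pi|rewrite (uniq s q) // qj].
    have [x xp] := of_some_flag p; exists x; split=> s Cs sr.
      by rewrite (uniq s p) // pi.
    by case: noj; exists s.
  have [[q [Cq qj]]|noj] := pselect (exists q, C q /\ sys_rank q = j).
    have [x xq] := of_some_flag q; exists x; split=> s Cs sr.
      by case: noi; exists s.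
    by rewrite (uniq s q) // qj.
  exists (sys_base S); split=> s Cs sr; first by case: noi; exists s.
  by case: noj; exists s.
have outer x p : ~~ (0 <= sys_rank p <= 2) -> of_flag x p.
  by have [y yp] := of_some_flag p => out; rewrite /of_flag yp; apply: lab_outer.
suff [z [z0 z1 z2]] : exists z, [/\ forall p, C p -> sys_rank p = 0 -> of_flag z p,
    forall p, C p -> sys_rank p = 1 -> of_flag z p &
    forall p, C p -> sys_rank p = 2 -> of_flag z p].
  exists z => p Cp /=; have [pb|] := boolP (0 <= sys_rank p <= 2); last exact: outer.
  have [r|[r|r]] : sys_rank p = 0 \/ sys_rank p = 1 \/ sys_rank p = 2 by lia.
  - exact: z0.
  - exact: z1.
  - exact: z2.
have [[p [Cp p1]]|no1] := pselect (exists p, C p /\ sys_rank p = 1); last first.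
  have [z [z0 z2]] := pair 0 2; exists z; split=> // q Cq q1.
  by case: no1; exists q.
have [x [x0 x1]] := pair 0 1; have [y [y1 y2]] := pair 1 2.
have [|z [z0 z1 z2]] := @lab_exchange 0 1 2 x y isT isT.
  by rewrite -p1 -(x1 p) // -(y1 p).
exists z; split=> q Cq qr.
- by have := x0 q Cq qr; rewrite /of_flag qr z0.
- by have := x1 q Cq qr; rewrite /of_flag qr z1.
- by have := y2 q Cq qr; rewrite /of_flag qr z2.
Qed.

Lemma of_flag_sub x y :
  [set p | of_flag x p] `<=` [set p | of_flag y p] -> x = y.
Proof.
move=> xy; apply: lab_inj => i ib.
have [|p xp pi] := @sys_face_of x i; first by lia.
by rewrite -pi -xp; apply: xy.
Qed.

Lemma sys_flagP (C : set sys_face) :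
  flag C <-> exists x, C = [set p | of_flag x p].
Proof.
split=> [[totC maxC]|[x ->]].
  have [x Cx] := chain_of_flag totC; exists x.
  by rewrite (maxC _ (of_flag_total (x := x)) Cx).
split; first exact: of_flag_total.
move=> D totD xD; have [y Dy] := chain_of_flag totD.
have xy : x = y by apply: of_flag_sub; apply: subset_trans xD Dy.
by apply/seteqP; split=> //; rewrite xy.
Qed.

Lemma sys_rank_mono : {homo sys_rank : p q / (p < q)%O >-> p < q}.
Proof. by move=> p q /sys_ltP[]. Qed.

Lemma sys_rank_range : range sys_rank = [set i : int | -1 <= i <= 3].
Proof.
apply/seteqP; split=> [_ [p _ <-]|i ib]; first exact: sys_rank_bounds.
by have [p _ pi] := sys_face_of (sys_base S) ib; exists p.
Qed.

Lemma of_flag_outer x p : ~~ (0 <= sys_rank p <= 2) -> of_flag x p.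
Proof.
by have [y yp] := of_some_flag p => out; rewrite /of_flag yp; apply: lab_outer.
Qed.

Lemma sys_least : exists p : sys_face, forall q, (p <= q)%O.
Proof.
have [//|p xp pi] := @sys_face_of (sys_base S) (-1).
exists p => q; have [x xq] := of_some_flag q.
apply: (@sys_le_of x) => //; first by apply: of_flag_outer; rewrite pi.
by rewrite pi; have /andP[] := sys_rank_bounds q.
Qed.

Lemma sys_greatest : exists p : sys_face, forall q, (q <= p)%O.
Proof.
have [//|p xp pi] := @sys_face_of (sys_base S) 3.
exists p => q; have [x xq] := of_some_flag q.
apply: (@sys_le_of x) => //; first by apply: of_flag_outer; rewrite pi.
by rewrite pi; have /andP[] := sys_rank_bounds q.
Qed.

Lemma sys_flag_card (C : set sys_face) : flag C -> C #= `I_5.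
Proof.
move=> /sys_flagP[x ->].
have ex (i : 'I_5) : exists p, of_flag x p /\ sys_rank p = i%:Z - 1.
  have [|p xp pi] := @sys_face_of x (i%:Z - 1); last by exists p.
  by have := ltn_ord i; lia.
have [g gP] := choice ex; apply/card_eq_IP; exists g.
  move=> i j gij; have := (gP i).2; rewrite gij (gP j).2 => e.
  by apply: val_inj => /=; lia.
apply/seteqP; split=> [p xp|_ [i _ <-]]; last exact: (gP i).1.
have pb := sys_rank_bounds p.
have ib : (absz (sys_rank p + 1)%R < 5)%N by lia.
exists (Ordinal ib) => //; apply: (of_flag_inj (gP _).1 xp).
by rewrite (gP _).2 /=; lia.
Qed.

Lemma sys_adjacent x i : 0 <= i <= 2 ->
  adjacent [set p | of_flag x p] [set p | of_flag (swap i x) p].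
Proof.
move=> ib; have ib' : -1 <= i <= 3 by lia.
have diff y z : lab i y <> lab i z -> (forall j, j <> i -> lab j y = lab j z) ->
    exists p, [set p | of_flag y p] `\` [set p | of_flag z p] = [set p].
  move=> yz yzj; have [p yp pi] := sys_face_of y ib'; exists p.
  apply/seteqP; split=> [q [yq zq]|_ ->]; last first.
    split=> // zp; apply: yz; rewrite -pi -[RHS]zp; exact/esym.
  apply: (of_flag_inj yq yp); rewrite pi; apply: contrapT => qi; apply: zq.
  by rewrite /= /of_flag -yzj.
have [||p pE] := diff x (swap i x).
- exact/nesym/lab_swap_neq.
- by move=> j ji; rewrite lab_swap.
have [||q qE] := diff (swap i x) x.
- exact: lab_swap_neq.
- by move=> j ji; rewrite lab_swap.
by exists p, q.
Qed.

Lemma sys_flag_connected : @strongly_flag_connected _ sys_face.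
Proof.
move=> _ _ /sys_flagP[x ->] /sys_flagP[y ->].
have [w wP yE] := sys_connected x y.
(* [foldr] applies the last letter first, so the k-th flag of the path uses the last k letters. *)
pose c (k : nat) := foldr swap x (drop (size w - k) w).
exists (size w), (fun k : nat => [set p | of_flag (c k) p]); split.
- by rewrite /c subn0 drop_size.
- by rewrite /c subnn drop0 -yE.
- move=> k kw; split; first by apply/sys_flagP; exists (c k).
  move=> p [/= xp yp]; rewrite /of_flag xp /c.
  have : {subset drop (size w - k)%N w <= w} by move=> i; apply: mem_drop.
  elim: (drop _ w) => //= i v IH sub.
  have [ib xy] := wP i (sub i (mem_head _ _)).
  rewrite lab_swap //; first by apply: IH => j jv; apply: sub; rewrite inE jv orbT.
  by move=> pi; apply: xy; rewrite -pi -xp yp.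
- move=> k kw; rewrite /c (_ : (size w - k = (size w - k.+1).+1)%N); last by lia.
  have lw : (size w - k.+1 < size w)%N by lia.
  rewrite (drop_nth 0 lw) /=; apply: sys_adjacent.
  by have [] := wP _ (mem_nth 0 lw).
Qed.

Lemma sys_diamond i (p q : sys_face) : 0 <= i <= 2 -> (p < q)%O ->
  sys_rank p = i - 1 -> sys_rank q = i + 1 ->
  [set s : sys_face | sys_rank s = i /\ (p < s < q)%O] #= `I_2.
Proof.
move=> ib /sys_ltP[_ [x [xp xq]]] pi qi; have ib' : -1 <= i <= 3 by lia.
have [s xs si] := sys_face_of x ib'; have [u xu ui] := sys_face_of (swap i x) ib'.
have su : s <> u.
  move=> e; apply: (@lab_swap_neq S i x ib).
  by have := xu; rewrite -e /of_flag xs si.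
have xp' : of_flag (swap i x) p by rewrite /of_flag lab_swap //; lia.
have xq' : of_flag (swap i x) q by rewrite /of_flag lab_swap //; lia.
rewrite (_ : [set _ | _] = [set s; u]); first exact: card_set2.
apply/seteqP; split=> [v [vi /andP[/sys_ltP[_ [y [yp yv]]]]]|_ [->|->]]; last 2 first.
- by split=> //; apply/andP; split; apply: (@sys_lt x) => //; lia.
- by split=> //; apply/andP; split; apply: (@sys_lt (swap i x)) => //; lia.
move=> /sys_ltP[_ [z [zv zq]]].
have [|||t [ty tv tz]] := @lab_exchange (i - 1) i (i + 1) y z; try lia.
  by rewrite -vi -yv -zv.
have tp : lab (i - 1) t = lab (i - 1) x by rewrite ty -pi -yp -xp.
have tq : lab (i + 1) t = lab (i + 1) x by rewrite tz -qi -zq -xq.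
have tv' : of_flag t v by rewrite /of_flag vi tv -vi.
have [ti|ti] := lab_diamond ib tp tq; [left|right].
  by apply: (@of_flag_inj x) => //; rewrite ?vi // /of_flag tv' vi.
by apply: (@of_flag_inj (swap i x)) => //; rewrite ?vi // /of_flag tv' vi.
Qed.

Definition sys_polytope : polytope3 := Polytope3 sys_rank_mono sys_rank_range
  sys_least sys_greatest sys_flag_card sys_flag_connected sys_diamond.

End SystemFaces.

(** * Rotary systems *)

Section SystemPolytopeFlags.
Variable S : flag_system.
Implicit Types (x y : sys_flag S) (i : int).

Definition flag_of_sys x : flag_of (sys_polytope S) :=
  @FlagOf (sys_polytope S) [set p | of_flag x p]
    (proj2 (@sys_flagP S [set p | of_flag x p]) (ex_intro _ x erefl)).

Lemma flag_of_sys_inj : injective flag_of_sys.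
Proof.
move=> x y /(congr1 (@flag_set _)) /= e; apply: of_flag_sub.
by rewrite e.
Qed.

Lemma flag_of_sys_surj t : exists x, t = flag_of_sys x.
Proof.
have [x tx] := (@sys_flagP S (flag_set t)).1 (flag_setP t).
by exists x; apply: flag_of_inj; rewrite tx.
Qed.

Lemma nbr_flag_of_sys i x : 0 <= i <= 2 ->
  nbr i (flag_of_sys x) = flag_of_sys (swap i x).
Proof.
move=> ib; symmetry; apply: nbr_uniq => // [/flag_of_sys_inj e|j jb ji].
  by apply: (@lab_swap_neq S i x ib); rewrite e.
have jb' : -1 <= j <= 3 by lia.
have [px rx] := elP (flag_of_sys x) jb'.
have [py ry] := elP (flag_of_sys (swap i x)) jb'.
apply: (of_flag_inj (x := x)) => //; last by rewrite [LHS]ry.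
by move: py; rewrite /= /of_flag lab_swap // [sys_rank _]ry.
Qed.

End SystemPolytopeFlags.

Section FiniteRoots.
Variables (O : finType) (f : O -> O).
Hypothesis fI : injective f.

Lemma frootP x y : froot f x = froot f y <-> exists k, y = iter k f x.
Proof.
have sym := fconnect_sym fI; split=> [/(fingraph.rootP sym)|[k ->]].
  by move=> xy; exists (findex f x y); rewrite iter_findex.
by apply/(fingraph.rootP sym); apply: fconnect_iter.
Qed.

Lemma froot1 x : froot f (f x) = froot f x.
Proof. by symmetry; apply/frootP; exists 1%N. Qed.

End FiniteRoots.

(* A group generated by a face rotation [s] and an involution [tau] reversing an
   edge, acting on [O]; the vertex rotation is [s^-1 tau].  The flag (x, false)
   is the flag x itself and (x, true) its neighbour across the vertex. *)
Section RotarySystems.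
Variables (O : finType) (s s' tau : O -> O) (x0 : O) (k1 k2 : nat).
Hypotheses (sK : cancel s s') (s'K : cancel s' s) (tauK : involutive tau).
Definition vrot x := s' (tau x).
Hypotheses (k1_gt1 : (1 < k1)%N) (k2_gt1 : (1 < k2)%N).
Hypothesis s_period : forall x k, iter k s x = x <-> (k1 %| k)%N.
Hypothesis vrot_period : forall x k, iter k vrot x = x <-> (k2 %| k)%N.
Hypothesis face_vertex : forall x k l, iter k s x = iter l vrot x ->
  iter k s x = x.
Hypothesis rot_connected : forall x y,
  connect (fun x y => (y == s x) || (y == tau x)) x y.
Hypothesis homogeneous : forall x y, exists2 g : O -> O, g x = y &
  forall z, g (s z) = s (g z) /\ g (tau z) = tau (g z).
Hypothesis irreflexible : forall g : O -> O,
  ~ (forall z, g (s z) = s' (g z) /\ g (tau z) = tau (g z)).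
Implicit Types (x y z : O) (X Y : O * bool).

Let sI : injective s. Proof. exact: can_inj sK. Qed.
Let tauI : injective tau. Proof. exact: can_inj tauK. Qed.
Let rI : injective vrot.
Proof. by move=> x y /(can_inj s'K)/tauI. Qed.

Let s_neq x : s x <> x.
Proof. by move/(s_period x 1).1; rewrite dvdn1; case: k1 k1_gt1 => [|[]]. Qed.

Let r_neq x : vrot x <> x.
Proof. by move/(vrot_period x 1).1; rewrite dvdn1; case: k2 k2_gt1 => [|[]]. Qed.

(** The intersection condition [face_vertex] in terms of faces: an even flag is determined by its
    vertex and 2-face. The diamond property at edges depends on it. *)
Let VF_inj x y : froot vrot x = froot vrot y -> froot s x = froot s y -> x = y.
Proof.
move=> /(frootP rI)[l ->] /(frootP sI)[k e].
by rewrite e; symmetry; apply: (face_vertex (l := l)).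
Qed.

Let V_tau x : froot vrot (tau x) = froot vrot (s' x).
Proof. by rewrite -(froot1 rI) /vrot tauK. Qed.

Let F_s' x : froot s (s' x) = froot s x.
Proof. by rewrite -(froot1 sI) s'K. Qed.

Let V_tau_neq x : froot vrot (tau x) <> froot vrot x.
Proof.
rewrite V_tau => e; apply: (@s_neq (s' x)); rewrite s'K.
by symmetry; apply: VF_inj; rewrite ?F_s'.
Qed.

Let F_tau_neq x : froot s (tau x) <> froot s x.
Proof.
have -> : tau x = s (vrot x) by rewrite /vrot s'K.
rewrite (froot1 sI) => e; apply: (@r_neq x); apply: VF_inj => //.
exact: froot1.
Qed.

Let E_eq x y : froot tau x = froot tau y -> y = x \/ y = tau x.
Proof.
move=> /(frootP tauI)[k ->]; elim: k => [|k [IH|IH]]; [by left| |]; rewrite /= IH.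
  by right.
by left; rewrite tauK.
Qed.

Let E_s_neq x : froot tau (s x) <> froot tau x.
Proof.
move=> e; case: (E_eq (esym e)) => [/s_neq//|sx].
by apply: (@F_tau_neq x); rewrite -sx (froot1 sI).
Qed.

(** Vertices, edges and 2-faces are the orbits of [vrot], [tau] and [s], named by their [froot]
    representatives. The flag (x, true) has the other end of the edge, which is the vertex of
    [tau x]. *)
Definition rot_lab (i : int) X : O :=
  if i == 0 then froot vrot (if X.2 then tau X.1 else X.1)
  else if i == 1 then froot tau X.1
  else if i == 2 then froot s X.1 else x0.

Definition rot_swap (i : int) X : O * bool :=
  if i == 0 then (X.1, ~~ X.2)
  else if i == 1 then (if X.2 then (s' X.1, false) else (s X.1, true))
  else (tau X.1, ~~ X.2).

Let int3 (i : int) : 0 <= i <= 2 -> [\/ i = 0, i = 1 | i = 2].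
Proof.
case: (eqVneq i 0) => [|i0]; first by constructor 1.
by case: (eqVneq i 1) => [|i1]; [constructor 2 | constructor 3; lia].
Qed.

Lemma rot_lab_outer i X Y : ~~ (0 <= i <= 2) -> rot_lab i X = rot_lab i Y.
Proof. by move=> ib; rewrite /rot_lab !ifN_eq //; apply: contraNneq ib => ->. Qed.

Lemma rot_lab_inj X Y :
  (forall i, 0 <= i <= 2 -> rot_lab i X = rot_lab i Y) -> X = Y.
Proof.
case: X Y => [x e] [y e'] H.
have := H 0 isT; have := H 1 isT; have := H 2 isT; rewrite /rot_lab /= => F.
case/E_eq => yx; rewrite {}yx in F *; last by case: (F_tau_neq (esym F)).
by case: e e' {H} => [] [] //= V0; [case: (V_tau_neq V0) | case: (V_tau_neq (esym V0))].
Qed.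

Lemma rot_lab_swap (i j : int) X : 0 <= i <= 2 -> j <> i ->
  rot_lab j (rot_swap i X) = rot_lab j X.
Proof.
move=> /int3 ib ji; have [jb|jb] := boolP (0 <= j <= 2); last exact: rot_lab_outer.
case: X => x e; rewrite /rot_lab /rot_swap.
case: ib ji => ->; case/int3: jb => -> //= _; case: e => //=.
- by rewrite V_tau sK.
- exact: froot1.
- by rewrite tauK.
- exact: froot1.
- exact: froot1.
Qed.

Lemma rot_lab_swap_neq (i : int) X : 0 <= i <= 2 ->
  rot_lab i (rot_swap i X) <> rot_lab i X.
Proof.
case: X => x e /int3 [] ->; rewrite /rot_lab /rot_swap /=.
- by case: e => /= [/esym|]; apply: V_tau_neq.
- by case: e => /=; [rewrite -{2}(s'K x) => /esym|]; apply: E_s_neq.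
- exact: F_tau_neq.
Qed.

(* The even flag with the same vertex and 2-face. *)
Definition even_part X := if X.2 then s' X.1 else X.1.

Let V_even X : froot vrot (if X.2 then tau X.1 else X.1) = froot vrot (even_part X).
Proof. by rewrite /even_part; case: X.2; rewrite ?V_tau. Qed.

Let F_even X : froot s X.1 = froot s (even_part X).
Proof. by rewrite /even_part; case: X.2; rewrite ?F_s'. Qed.

Lemma rot_lab_diamond (i : int) X Y : 0 <= i <= 2 ->
  rot_lab (i - 1) Y = rot_lab (i - 1) X ->
  rot_lab (i + 1) Y = rot_lab (i + 1) X ->
  rot_lab i Y = rot_lab i X \/ rot_lab i Y = rot_lab i (rot_swap i X).
Proof.
case: X Y => [x e] [y e'] /int3 [] ->; rewrite /rot_lab /rot_swap /=.
- move=> _ /esym /E_eq[->|->]; case: e e' => [] []; rewrite ?tauK; auto.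
- rewrite (V_even (y, e')) (V_even (x, e)) => V01.
  rewrite (F_even (y, e')) (F_even (x, e)) => F01.
  move: (VF_inj V01 F01) => {V01 F01}; rewrite /even_part /=.
  case: e e' => [] [] /=.
  + by move/(can_inj s'K) => ->; left.
  + by move=> ->; right.
  + by move=> <-; right; rewrite s'K.
  + by move=> ->; left.
- by move=> /esym /E_eq[->|->]; auto.
Qed.

Let reach (K : int -> Prop) X Y := exists2 w : seq int,
  (forall i, i \in w -> K i) & Y = foldr rot_swap X w.

Let reach_refl K X : reach K X X.
Proof. by exists [::]. Qed.

Let reach_step (K : int -> Prop) i X Y : K i -> reach K X Y ->
  reach K X (rot_swap i Y).
Proof.
move=> Ki [w wK ->]; exists (i :: w) => // j.
by rewrite inE => /orP[/eqP->|/wK].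
Qed.

Let reach_trans K X Y Z : reach K X Y -> reach K Y Z -> reach K X Z.
Proof.
move=> [v vK ->] [w wK ->]; exists (w ++ v); last by rewrite foldr_cat.
by move=> i; rewrite mem_cat => /orP[/wK|/vK].
Qed.

Let to_even0 (K : int -> Prop) X : K 0 -> reach K X (X.1, false).
Proof.
case: X => x [] K0 /=; last exact: reach_refl.
exact: (reach_step K0 (reach_refl K (x, true))).
Qed.

Let of_even0 (K : int -> Prop) x e : K 0 -> reach K (x, false) (x, e).
Proof.
case: e => K0; last exact: reach_refl.
exact: (reach_step K0 (reach_refl K (x, false))).
Qed.

Let to_even1 (K : int -> Prop) X : K 1 -> reach K X (even_part X, false).
Proof.
case: X => x [] K1 /=; last exact: reach_refl.
exact: (reach_step K1 (reach_refl K (x, true))).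
Qed.

Let of_even1 (K : int -> Prop) X : K 1 -> reach K (even_part X, false) X.
Proof.
case: X => x [] K1 /=; last exact: reach_refl.
by have := reach_step K1 (reach_refl K (s' x, false)); rewrite /rot_swap /= s'K.
Qed.

Let reach_iter K (f : O -> O) x k :
  (forall x, reach K (x, false) (f x, false)) ->
  reach K (x, false) (iter k f x, false).
Proof.
by move=> fR; elim: k => [|k IH]; [apply: reach_refl | apply: reach_trans IH _].
Qed.

Let s_reach (K : int -> Prop) x : K 0 -> K 1 -> reach K (x, false) (s x, false).
Proof.
move=> K0 K1; have := reach_step K0 (reach_step K1 (reach_refl K (x, false))).
by [].
Qed.

Let vrot_reach (K : int -> Prop) x : K 1 -> K 2 ->
  reach K (x, false) (vrot x, false).
Proof.
move=> K1 K2; have := reach_step K1 (reach_step K2 (reach_refl K (x, false))).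
by [].
Qed.

Let tau_reach (K : int -> Prop) x : K 0 -> K 2 ->
  reach K (x, false) (tau x, false).
Proof.
move=> K0 K2; have := reach_step K0 (reach_step K2 (reach_refl K (x, false))).
by [].
Qed.

(** If the flags differ in one rank, the diamond property joins them. If they differ in two, they
    share a face, so one is reached from the other by the rotation about it, written in these two
    letters. If they differ in all three, every letter is allowed and [rot_connected] applies. *)
Lemma rot_system_connected X Y : exists2 w : seq int,
  (forall i, i \in w -> 0 <= i <= 2 /\ rot_lab i X <> rot_lab i Y) &
  Y = foldr rot_swap X w.
Proof.
pose K i := 0 <= i <= 2 /\ rot_lab i X <> rot_lab i Y.
rewrite -/(reach K X Y).
have two i : 0 <= i <= 2 -> K i ->
    (forall j, 0 <= j <= 2 -> j <> i -> rot_lab j X = rot_lab j Y) -> reach K X Y.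
  move=> ib Ki XY; rewrite (_ : Y = rot_swap i X).
    exact: (reach_step Ki (reach_refl K X)).
  have XY' j : j <> i -> rot_lab j Y = rot_lab j X.
    have [jb|jb] := boolP (0 <= j <= 2); first by move=> /(XY _ jb).
    by move=> _; apply: rot_lab_outer.
  have [||e|e] := @rot_lab_diamond i X Y ib.
  - by apply: XY'; lia.
  - by apply: XY'; lia.
  - by case: Ki => _; rewrite e.
  - apply: rot_lab_inj => j jb; have [->//|/eqP ji] := eqVneq j i.
    by rewrite rot_lab_swap // XY'.
have [e0|n0] := eqVneq (rot_lab 0 X) (rot_lab 0 Y);
have [e1|n1] := eqVneq (rot_lab 1 X) (rot_lab 1 Y);
have [e2|n2] := eqVneq (rot_lab 2 X) (rot_lab 2 Y).
- rewrite (_ : Y = X); first exact: reach_refl.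
  by apply: rot_lab_inj => i /int3[] ->.
- by apply: (two 2) => //; [split=> //; apply/eqP | move=> j /int3[] ->].
- by apply: (two 1) => //; [split=> //; apply/eqP | move=> j /int3[] ->].
- have K1 : K 1 by split=> //; apply/eqP.
  have K2 : K 2 by split=> //; apply/eqP.
  apply: (reach_trans (to_even1 _ K1)); apply: reach_trans (of_even1 _ K1).
  move: e0; rewrite /rot_lab /= !V_even => /(frootP rI)[k ->].
  by apply: reach_iter => x; apply: vrot_reach.
- by apply: (two 0) => //; [split=> //; apply/eqP | move=> j /int3[] ->].
- have K0 : K 0 by split=> //; apply/eqP.
  have K2 : K 2 by split=> //; apply/eqP.
  rewrite (surjective_pairing Y).
  apply: (reach_trans (to_even0 _ K0)); apply: reach_trans (of_even0 _ _ K0).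
  move: e1; rewrite /rot_lab /= => /(frootP tauI)[k ->].
  by apply: reach_iter => x; apply: tau_reach.
- have K0 : K 0 by split=> //; apply/eqP.
  have K1 : K 1 by split=> //; apply/eqP.
  rewrite (surjective_pairing Y).
  apply: (reach_trans (to_even0 _ K0)); apply: reach_trans (of_even0 _ _ K0).
  move: e2; rewrite /rot_lab /= => /(frootP sI)[k ->].
  by apply: reach_iter => x; apply: s_reach.
- have K0 : K 0 by split=> //; apply/eqP.
  have K1 : K 1 by split=> //; apply/eqP.
  have K2 : K 2 by split=> //; apply/eqP.
  rewrite (surjective_pairing Y).
  apply: (reach_trans (to_even0 _ K0)); apply: reach_trans (of_even0 _ _ K0).
  case/connectP: (rot_connected X.1 Y.1) => p.
  elim: p (X.1) => [x _ ->|y p IH x /= /andP[xy py] yl]; first exact: reach_refl.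
  apply: reach_trans (IH y py yl).
  by case/orP: xy => /eqP->; [apply: s_reach | apply: tau_reach].
Qed.

Definition rotary_system : flag_system := FlagSystem (x0, false) rot_lab_outer
  rot_lab_inj rot_lab_swap rot_lab_swap_neq rot_lab_diamond rot_system_connected.

Local Notation P := (sys_polytope rotary_system).
Local Notation fl := (@flag_of_sys rotary_system).

Let nbr_fl (i : int) X : 0 <= i <= 2 -> nbr i (fl X) = fl (rot_swap i X).
Proof. exact: (@nbr_flag_of_sys rotary_system). Qed.

Let swap_s x : rot_swap 0 (rot_swap 1 (x, false)) = (s x, false).
Proof. by []. Qed.

Let hom_s' (g : O -> O) : (forall z, g (s z) = s (g z)) ->
  forall z, g (s' z) = s' (g z).
Proof. by move=> gs z; apply: sI; rewrite -gs !s'K. Qed.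

Let hom_id (g : O -> O) x :
  (forall z, g (s z) = s (g z) /\ g (tau z) = tau (g z)) -> g x = x ->
  forall y, g y = y.
Proof.
move=> gC gx y; case/connectP: (rot_connected x y) => p.
elim: p x gx => [x gx _ -> //|z p IH x gx /= /andP[xz pz]]; apply: IH => //.
by case/orP: xz => /eqP->; rewrite ?(gC _).1 ?(gC _).2 gx.
Qed.

Let orbit_fl x y e : exists2 f, @Aut P f & img f (fl (x, e)) = fl (y, e).
Proof.
have [g gx gC] := homogeneous x y; have [h hy hC] := homogeneous y x.
have hK z : h (g z) = z.
  apply: (@hom_id (h \o g) x) => [{}z /=|/=]; last by rewrite gx.
  by rewrite (gC z).1 (gC z).2 (hC _).1 (hC _).2.
have gK z : g (h z) = z.
  apply: (@hom_id (g \o h) y) => [{}z /=|/=]; last by rewrite hy.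
  by rewrite (hC z).1 (hC z).2 (gC _).1 (gC _).2.
have [pre preP] := choice (@flag_of_sys_surj rotary_system).
pose lift (k : O -> O) t := fl (k (pre t).1, (pre t).2).
have liftE k X : lift k (fl X) = fl (k X.1, X.2).
  by rewrite /lift; have /flag_of_sys_inj <- := preP (fl X).
have liftK k k' : (forall z, k' (k z) = z) -> cancel (lift k) (lift k').
  move=> kK t; have [X ->] := flag_of_sys_surj t.
  by rewrite !liftE /= kK -surjective_pairing.
have [f Af fE] : exists2 f, @Aut P f & forall t, img f t = lift g t.
  apply: (flag_map_Aut (liftK _ _ hK) (liftK _ _ gK)) => i t ib.
  have [[z a] ->] := flag_of_sys_surj t; rewrite liftE nbr_fl // liftE nbr_fl //.
  case/int3: ib => ->; rewrite /rot_swap //=.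
    by case: a => /=; rewrite ?(gC z).1 ?(hom_s' (fun z => (gC z).1)).
  by rewrite (gC z).2.
by exists f => //; rewrite fE liftE /= gx.
Qed.

(** Such an automorphism would send every even flag to an odd one. On odd flags the word for [s]
    acts as [s'] and the word for [tau] as [tau], so a map excluded by [irreflexible] would
    arise. *)
Let no_reflection f x y : @Aut P f -> img f (fl (x, false)) <> fl (y, true).
Proof.
move=> Af fxy.
have word (i j : int) (z : O * bool) : 0 <= i <= 2 -> 0 <= j <= 2 ->
    img f (fl (rot_swap i (rot_swap j z))) = nbr i (nbr j (img f (fl z))).
  by move=> ib jb; rewrite -!nbr_fl // !img_nbr.
have ex z : exists a, img f (fl (z, false)) = fl (a, true).
  case/connectP: (rot_connected x z) => p.
  elim: p x y fxy => [x0' y0 e _ -> /=|u p IH x1 y1 e /= /andP[xu pu]].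
    by exists y0.
  case/orP: xu pu => /eqP-> pu; apply: (IH _ _ _ pu).
    by rewrite -swap_s word // e !nbr_fl //; reflexivity.
  rewrite -[(tau x1, false)]/(rot_swap 0 (rot_swap 2 (x1, false))) word //.
  by rewrite e !nbr_fl //; reflexivity.
have [g gE] := choice ex; apply: (@irreflexible g) => z; split.
  have := gE (s z); rewrite -swap_s word // gE !nbr_fl //.
  by move=> /flag_of_sys_inj[].
have := gE (tau z).
rewrite -[(tau z, false)]/(rot_swap 0 (rot_swap 2 (z, false))) word //.
by rewrite gE !nbr_fl // => /flag_of_sys_inj[].
Qed.

Lemma rotary_parity : exists2 par : flag_of P -> bool,
  (forall X, par (fl X) = X.2) &
  (forall i t, 0 <= i <= 2 -> par (nbr i t) = ~~ par t) /\
  (forall t u, par t = par u <-> exists2 f, Aut f & img f t = u).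
Proof.
have [pre preP] := choice (@flag_of_sys_surj rotary_system).
have parE X : (pre (fl X)).2 = X.2.
  by have /flag_of_sys_inj <- := preP (fl X).
exists (fun t => (pre t).2) => //; split=> [i t ib|t u].
  have [X ->] := flag_of_sys_surj t; rewrite nbr_fl // !parE.
  by case: X => x e; case/int3: ib => ->; case: e.
have [[x e] ->] := flag_of_sys_surj t; have [[y e'] ->] := flag_of_sys_surj u.
rewrite !parE /=; split=> [->|[f Af fxy]]; first exact: orbit_fl.
case: e e' fxy => [] [] // fxy; last by case: (no_reflection Af fxy).
have [h Ah hK] : exists2 h, @Aut P h & img h (fl (y, false)) = fl (x, true).
  have [f' [fK f'K fm f'm]] := Af.
  have Af' : Aut f' by exists f.
  exists f' => //; rewrite -fxy -img_comp // -[RHS]img_id; congr img.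
  exact/funext.
by case: (no_reflection Ah hK).
Qed.

Lemma rotary_chiral : chiral_of_order_type #|O| k1 k2 P.
Proof.
have [par parE [parN parP]] := rotary_parity.
split; first by apply/chiral_parity; exists par.
  apply: card_eq_trans (card_range (g := fun x => fl (x, false)) _); last first.
    by move=> x y /flag_of_sys_inj[].
  have -> : range (fun x => fl (x, false)) =
      (fun f => img f (fl (x0, false))) @` @Aut P.
    apply/seteqP; split=> [_ [x _ <-]|_ [f Af <-]].
      by have [f Af fE] := orbit_fl x0 x false; exists f.
    have [[y e] yE] := flag_of_sys_surj (img f (fl (x0, false))).
    have : par (fl (x0, false)) = par (fl (y, e)).
      by apply/parP; exists f.
    by rewrite !parE /= => ee; exists y; rewrite // yE -ee.
  apply: card_esym; apply: inj_card_eq => f g /set_mem Af /set_mem Ag.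
  exact: img_inj.
have itF x k : iter k (rot 0) (fl (x, false)) = fl (iter k s x, false).
  by elim: k => //= k ->; rewrite /rot !nbr_fl.
(* On odd flags [rot 2] is conjugate to [vrot] by [tau]; on even flags it would be the inverse of
   [vrot]. *)
have itV x k : iter k (rot 2) (fl (x, true)) = fl (tau (iter k vrot (tau x)), true).
  elim: k => [|k IH] /=; first by rewrite tauK.
  by rewrite IH /rot !nbr_fl //= /rot_swap /= /vrot tauK.
have iter_F x k : iter k (rot 0) (fl (x, false)) = fl (x, false) <-> (k1 %| k)%N.
  rewrite -(s_period x k) itF; split=> [/flag_of_sys_inj[]//|-> //].
have iter_V x k : iter k (rot 2) (fl (x, true)) = fl (x, true) <-> (k2 %| k)%N.
  rewrite -(vrot_period (tau x) k) itV; split=> [/flag_of_sys_inj[e]|->].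
    by rewrite -{2}e tauK.
  by rewrite tauK.
have k10 : (0 < k1)%N by apply: ltnW.
have k20 : (0 < k2)%N by apply: ltnW.
split=> F rF.
  have [x xF] : exists x, el (fl (x, false)) 2 = F.
    have [t tF] := flag_through F; have [[x [|]] xt] := flag_of_sys_surj t.
      exists x; rewrite -[(x, false)]/(rot_swap 0 (x, true)) -nbr_fl // el_nbr //.
      by rewrite -xt -rF.
    by exists x; rewrite -xt -rF.
  by rewrite -xF; split; apply: (rot_period_incident parN (i := 0) _ _ k10 (iter_F x)); auto.
have [x xF] : exists x, el (fl (x, true)) 0 = F.
  have [t tF] := flag_through F; have [[x [|]] xt] := flag_of_sys_surj t.
    by exists x; rewrite -xt -rF.
  exists (tau x); rewrite -[(tau x, true)]/(rot_swap 2 (x, false)) -nbr_fl // el_nbr //.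
  by rewrite -xt -rF.
by rewrite -xF; split; apply: (rot_period_incident parN (i := 2) _ _ k20 (iter_V x)); auto.
Qed.

End RotarySystems.

(** * Coverings of the square torus *)

(* Residues modulo 4 as pairs of bits, the low bit first. *)
Definition four := (bool * bool)%type.

Definition inc4 (k : four) : four := (~~ k.1, k.1 (+) k.2).
Definition dec4 (k : four) : four := (~~ k.1, ~~ (k.1 (+) k.2)).
Definition opp4 (k : four) : four := (k.1, k.1 (+) k.2).
Definition add4 (k l : four) : four := (k.1 (+) l.1, k.2 (+) l.2 (+) (k.1 && l.1)).

Arguments inc4 : simpl never.
Arguments dec4 : simpl never.
Arguments opp4 : simpl never.
Arguments add4 : simpl never.

(** The directions 0, 1, 2, 3 are east, north, west and south, that is, the powers of i. *)
Definition step4 (k : four) (q : four * four) : four * four :=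
  match k with
  | (false, false) => (inc4 q.1, q.2)
  | (true, false) => (q.1, inc4 q.2)
  | (false, true) => (dec4 q.1, q.2)
  | (true, true) => (q.1, dec4 q.2)
  end.

Arguments step4 : simpl never.

Definition rot4 (q : four * four) : four * four := (opp4 q.2, q.1).

Definition V5 := (bool * bool * bool * bool * bool)%type.

(* Voltages of the horizontal and vertical edges leaving a vertex of the square
   tessellation of the torus Z[i] / 4, in the kernel of a covering.  They were
   found by computer as a solution of [linX_volt] and [linR_volt], which say that
   the unit translation and the rotation by i lift to the covering. *)
Definition voltH (q : four * four) : V5 :=
  let: ((a0, a1), (b0, b1)) := q in
  (false, a0 && a1, b1 (+) a0 && a1, false, b0 && b1 (+) [&& a0, a1 & b0]).

Definition voltV (q : four * four) : V5 :=
  let: ((a0, a1), (b0, b1)) := q in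
  (a0, a1 (+) b0 && b1, b0 && b1,
   b0 && b1 (+) a1 && b0 (+) a0 && b1 (+) a0 && a1,
   a1 && b1 (+) [&& a0, b0 & b1] (+) [&& a0, a1 & b0]).

(** Steps west and south run backwards along an edge leaving the neighbouring point; since voltages
    have order 2, no sign appears. *)
Definition volt (q : four * four) (k : four) : V5 :=
  match k with
  | (false, false) => voltH q
  | (true, false) => voltV q
  | (false, true) => voltH (dec4 q.1, q.2)
  | (true, true) => voltV (q.1, dec4 q.2)
  end.

Arguments volt : simpl never.

Definition linX (v : V5) : V5 :=
  let: (v0, v1, v2, v3, v4) := v in
  (v0, v0 (+) v1, v2, v1 (+) v2 (+) v3, v3 (+) v4).

Definition gaugeX (q : four * four) : V5 :=
  let: ((a0, a1), (b0, b1)) := q in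
  (b0, a0 && a1, a0 && a1, b0 && b1 (+) a0 && b1, [&& a0, a1 & b0]).

Definition linR (v : V5) : V5 :=
  let: (v0, v1, v2, v3, v4) := v in
  (v0, v0 (+) v2, v1, v0 (+) v1 (+) v3, v0 (+) v1 (+) v2 (+) v4).

Definition gaugeR (q : four * four) : V5 :=
  let: ((a0, a1), (b0, b1)) := q in
  (a0 && b0, b1 (+) b0 (+) b0 && b1 (+) a0 && b0, b1 (+) b0 (+) b0 && b1,
   a1 && b1 (+) a1 && b0 (+) a0 && b0 (+) [&& a0, b0 & b1] (+) [&& a0, a1 & b0],
   a1 && b0 (+) a0 && b1 (+) [&& a1, b0 & b1] (+) [&& a0, b0 & b1]
     (+) [&& a0, a1 & b1] (+) [&& a0, a1 & b0]).

Lemma volt_back q k : volt (step4 k q) (inc4 (inc4 k)) = volt q k.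
Proof. by case: q k => [[[] []] [[] []]] [[] []]. Qed.

(** The lifted translation applies [linX] to the sheet and then shifts it by [gaugeX] of the
    position; the equation says that this lift commutes with crossing an edge. [linR_volt] is the
    analogue for the rotation. *)
Lemma linX_volt q k : linX (volt q k) + gaugeX (step4 k q) =
  gaugeX q + volt (step4 (false, false) q) k.
Proof. by case: q k => [[[] []] [[] []]] [[] []]. Qed.

Lemma linR_volt q k : linR (volt q k) + gaugeR (step4 k q) =
  gaugeR q + volt (rot4 q) (inc4 k).
Proof. by case: q k => [[[] []] [[] []]] [[] []]. Qed.

Lemma V5_addvv (v : V5) : v + v = 0.
Proof. by case: v => [[[[[] []] []] []] []]. Qed.

Lemma linXD v w : linX (v + w) = linX v + linX w.
Proof.
by case: v => [[[[[] []] []] []] []]; case: w => [[[[[] []] []] []] []].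
Qed.

Lemma linRD v w : linR (v + w) = linR v + linR w.
Proof.
by case: v => [[[[[] []] []] []] []]; case: w => [[[[[] []] []] []] []].
Qed.

Fixpoint voltw (q : four * four) (w : seq four) : V5 :=
  if w is k :: w' then volt q k + voltw (step4 k q) w' else 0.

Definition curv q k :=
  voltw q [:: k; inc4 k; inc4 (inc4 k); inc4 (inc4 (inc4 k))].

(** One bit that is set for every unit square keeps all curvatures non-zero, also in a quotient of
    the voltages whose kernel avoids this bit. *)
Lemma curv0 q k : (curv q k).1.1.1.1 = true.
Proof. by case: q k => [[[] []] [[] []]] [[] []]. Qed.

Definition q0 : four * four := ((false, false), (false, false)).

(** * The covering of a torus defined by voltages *)

Section TorusCover.
Variables (T : finZmodType) (J : T -> T) (u : T) (pr : T -> four * four).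
Hypotheses (JD : forall x y, J (x + y) = J x + J y) (JJ : forall x, J (J x) = - x).

Definition dirv (k : four) : T :=
  let v := if k.1 then J u else u in if k.2 then - v else v.

Hypothesis pr0 : pr 0 = q0.
Hypothesis pr_step : forall z k, pr (z + dirv k) = step4 k (pr z).
Hypothesis pr_rot : forall z, pr (J z) = rot4 (pr z).
Hypothesis T_gen : forall A : T -> Prop,
  A 0 -> (forall z k, A z -> A (z + dirv k)) -> forall z, A z.

Variables (E : finZmodType) (proj : V5 -> E).
Hypothesis projD : forall v w, proj (v + w) = proj v + proj w.
Hypothesis proj_surj : forall e, exists v, proj v = e.
Hypothesis proj_bit0 : forall v, proj v = 0 -> v.1.1.1.1 = false.
Hypothesis proj_linX : forall v, proj v = 0 -> proj (linX v) = 0.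
Hypothesis proj_linR : forall v, proj v = 0 -> proj (linR v) = 0.

Implicit Types (z : T) (k d : four) (e : E) (w : seq four).

(** An even flag: the centre of its 2-face in the torus, the direction of its edge seen from there,
    and the sheet. *)
Definition cover : finType := (T * four * E)%type.
Implicit Types x y : cover.

Definition cface x : cover := (x.1.1, inc4 x.1.2, x.2).
Definition cface' x : cover := (x.1.1, dec4 x.1.2, x.2).
Definition cedge x : cover :=
  (x.1.1 + dirv x.1.2, inc4 (inc4 x.1.2), x.2 + proj (volt (pr x.1.1) x.1.2)).

Let incK : cancel inc4 dec4. Proof. by case=> [[] []]. Qed.
Let decK : cancel dec4 inc4. Proof. by case=> [[] []]. Qed.

Let JN z : J (- z) = - J z.
Proof.
have J0 : J 0 = 0 by apply: (addrI (J 0)); rewrite -JD !addr0.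
by apply: (addrI (J z)); rewrite -JD !subrr.
Qed.

Let J_dirv k : J (dirv k) = dirv (inc4 k).
Proof. by case: k => [[] []]; rewrite /dirv /= ?JN ?JJ ?opprK. Qed.

Let dirv_back k : dirv (inc4 (inc4 k)) = - dirv k.
Proof. by case: k => [[] []]; rewrite /dirv /= ?opprK. Qed.

Let proj0 : proj 0 = 0.
Proof. by apply: (addrI (proj 0)); rewrite -projD !addr0. Qed.

Let eE e : e + e = 0.
Proof. by have [v <-] := proj_surj e; rewrite -projD V5_addvv proj0. Qed.

Lemma cfaceK : cancel cface cface'.
Proof. by case=> [[z k] e]; rewrite /cface /cface' /= incK. Qed.

Lemma cfaceK' : cancel cface' cface.
Proof. by case=> [[z k] e]; rewrite /cface /cface' /= decK. Qed.

Lemma cedgeK : involutive cedge.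
Proof.
case=> [[z k] e]; rewrite /cedge /= dirv_back addrK pr_step volt_back.
by rewrite -addrA eE addr0; case: k => [[] []].
Qed.

Local Notation cvert := (vrot cface' cedge).

Let cvert4 z k e : iter 4 cvert (z, k, e) = (z, k, e + proj (curv (pr z) k)).
Proof.
have zab (a b : T) : z + a + b - a - b = z.
  by rewrite (addrAC (z + a)) addrK addrK.
rewrite /= /vrot /cedge /cface' /= !incK !pr_step.
rewrite !dirv_back zab /curv /= !projD proj0 addr0 !addrA.
by congr (_, _, _); case: k => [[] []].
Qed.

Let cvert8 x : iter 8 cvert x = x.
Proof.
case: x => [[z k] e]; have -> : 8%N = (4 + 4)%N by [].
by rewrite iterD (cvert4 z k e) cvert4 -addrA eE addr0.
Qed.

Let cface4 x : iter 4 cface x = x.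
Proof. by case: x => [[z [[] []]] e]. Qed.

Let iter_mod m (f : cover -> cover) (k : nat) x : (forall x, iter m f x = x) ->
  iter k f x = iter (k %% m) f x.
Proof.
move=> fm; rewrite {1}(divn_eq k m) addnC iterD; congr iter.
by elim: (k %/ m)%N => // l IH; rewrite mulSn iterD IH.
Qed.

Let curv_neq0 q k : proj (curv q k) <> 0.
Proof. by move/proj_bit0; rewrite curv0. Qed.

Lemma cface_period x (k : nat) : iter k cface x = x <-> (4 %| k)%N.
Proof.
rewrite (iter_mod _ _ cface4) /dvdn.
case: x => [[z d] e]; case: (k %% 4)%N (ltn_pmod k (isT : 0 < 4)%N) => [|[|[|[|//]]]] _.
- by [].
- by split=> // -[] /=; case: d => [[] []].
- by split=> // -[] /=; case: d => [[] []].
- by split=> // -[] /=; case: d => [[] []].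
Qed.

(* Fewer than four vertex rotations move the edge away, and four of them change
   the last coordinate by a curvature. *)
Lemma cvert_pos z d e (k : nat) : (iter k cvert (z, d, e)).1.1 = z ->
  (4 %| k)%N /\ ((iter k cvert (z, d, e)).2 = e -> (8 %| k)%N).
Proof.
rewrite (iter_mod _ _ cvert8) /dvdn -(@modn_dvdm 8 k 4) //.
have step_neq e' r : (0 < r < 4)%N -> (iter r cvert (z, d, e')).1.1 <> z.
  move=> rb /(congr1 pr); case: r rb => [//|[|[|[|//]]]] _.
  - rewrite /= pr_step.
    by case: (pr z) d => [[[] []] [[] []]] [[] []].
  - rewrite /= /vrot /cedge /cface' /= !incK !pr_step.
    by case: (pr z) d => [[[] []] [[] []]] [[] []].
  - rewrite /= /vrot /cedge /cface' /= !incK !pr_step.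
    by case: (pr z) d => [[[] []] [[] []]] [[] []].
have four_neq r : (0 < r < 4)%N -> (iter (r + 4) cvert (z, d, e)).1.1 <> z.
  by rewrite iterD (cvert4 z d e); apply: step_neq.
case: (k %% 8)%N (ltn_pmod k (isT : 0 < 8)%N)
  => [|[|[|[|[|[|[|[|//]]]]]]]] _.
- by [].
- by move/(@step_neq e 1 isT).
- by move/(@step_neq e 2 isT).
- by move/(@step_neq e 3 isT).
- split=> //; rewrite (cvert4 z d e) /= => e4; case: (@curv_neq0 (pr z) d).
  by apply: (addrI e); rewrite e4 addr0.
- by move/(@four_neq 1 isT).
- by move/(@four_neq 2 isT).
- by move/(@four_neq 3 isT).
Qed.

Lemma cvert_period x (k : nat) : iter k cvert x = x <-> (8 %| k)%N.
Proof.
case: x => [[z d] e]; split=> [kx|]; last first.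
  by rewrite (iter_mod _ _ cvert8) /dvdn => /eqP->.
have [|_] := @cvert_pos z d e k; rewrite kx //.
by apply.
Qed.

Lemma cface_cvert x (k l : nat) : iter k cface x = iter l cvert x -> iter k cface x = x.
Proof.
case: x => [[z d] e] kl.
have kE : (iter k cface (z, d, e)).1.1 = z /\ (iter k cface (z, d, e)).2 = e.
  by elim: k {kl} => //= k [-> ->].
rewrite kl in kE *; have [_ /(_ kE.2)] := cvert_pos kE.1.
by move/cvert_period.
Qed.

Local Notation conn :=
  (connect (fun x y => (y == cface x) || (y == cedge x))).

Let conn_s x : conn x (cface x). Proof. by apply: connect1; rewrite eqxx. Qed.
Let conn_t x : conn x (cedge x). Proof. by apply: connect1; rewrite eqxx orbT. Qed.

Let conn_iter (j : nat) x : conn x (iter j cface x).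
Proof. by elim: j => //= j IH; apply: connect_trans IH (conn_s _). Qed.

Let conn_sym x y : conn x y -> conn y x.
Proof.
case/connectP=> p; elim: p x => [x _ -> //|y' p IH x /= /andP[xy' py'] yl].
apply: connect_trans (IH y' py' yl) _; case/orP: xy' => /eqP->.
  by rewrite -{2}(cface4 x) -[iter 4 _ _]/(iter 3 cface (cface x)).
by rewrite -{2}(cedgeK x).
Qed.

Let four_iter k k' : exists j, iter j inc4 k = k'.
Proof.
by case: k k' => [[] []] [[] []];
  first [by exists 0 | by exists 1%N | by exists 2%N | by exists 3%N].
Qed.

Let conn_dir z k k' e : conn (z, k, e) (z, k', e).
Proof.
have [j <-] := four_iter k k'.
suff -> : (z, iter j inc4 k, e) = iter j cface (z, k, e) by apply: conn_iter.
by elim: j => //= j <-.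
Qed.

Let conn_move z k d e :
  conn (z, k, e) (z + dirv d, k, e + proj (volt (pr z) d)).
Proof.
apply: connect_trans (conn_dir z k d e) _.
exact: connect_trans (conn_t _) (conn_dir _ _ _ _).
Qed.

Let conn_back z k d e :
  conn (z + dirv d, k, e) (z, k, e + proj (volt (pr z) d)).
Proof.
apply: conn_sym; have := conn_move z k d (e + proj (volt (pr z) d)).
by rewrite -addrA eE addr0.
Qed.

(** Here [c] is in the holonomy at [z]. As [E] is commutative, the holonomy is the same at all
    points. *)
Let loop z c := forall k e, conn (z, k, e) (z, k, e + c).

Let loop_curv z d : loop z (proj (curv (pr z) d)).
Proof.
move=> k e; apply: connect_trans (conn_dir z k d e) _.
apply: connect_trans _ (conn_dir z d k _); rewrite -(cvert4 z d e).
elim: 4%N => //= j IH; apply: connect_trans IH _; rewrite {2}/vrot.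
apply: connect_trans (conn_t _) _; apply: conn_sym.
by rewrite -{2}(cfaceK' (cedge _)).
Qed.

Let loop_step z d c : loop z c <-> loop (z + dirv d) c.
Proof.
split=> zc k e.
  apply: connect_trans (conn_back _ _ _ _) _; apply: connect_trans (zc _ _) _.
  apply: connect_trans (conn_move _ _ d _) _.
  by rewrite addrAC -(addrA e) eE addr0.
apply: connect_trans (conn_move _ _ d _) _; apply: connect_trans (zc _ _) _.
apply: connect_trans (conn_back _ _ _ _) _.
by rewrite addrAC -(addrA e) eE addr0.
Qed.

Let loop0 z c : loop z c <-> loop 0 c.
Proof.
move: z c; apply: T_gen => [//|z k IH c].
by rewrite -IH -loop_step.
Qed.

Let loopD c c' : loop 0 c -> loop 0 c' -> loop 0 (c + c').
Proof. by move=> lc lc' k e; apply: connect_trans (lc k e) _; rewrite addrA. Qed.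

Let loop_all e : loop 0 e.
Proof.
have lq q d : (exists z, pr z = q) -> loop 0 (proj (curv q d)).
  by move=> [z <-]; apply/(loop0 z)/loop_curv.
have qS q k : (exists z, pr z = q) -> exists z, pr z = step4 k q.
  by move=> [z <-]; exists (z + dirv k).
have qq0 : exists z, pr z = q0 by exists 0.
pose east : four := (false, false); pose north : four := (true, false).
(* The curvatures at 0, 1, i, 2 and 2 + i generate all voltages: the first is the unit vector of bit
   0, adding it to the next three isolates bits 1 to 3, and the last one yields bit 4. *)
have l00 := lq _ east qq0.
have l10 := lq _ east (qS _ east qq0).
have l01 := lq _ east (qS _ north qq0).
have l20 := lq _ east (qS _ east (qS _ east qq0)).
have l21 := lq _ east (qS _ north (qS _ east (qS _ east qq0))).
have b0 : loop 0 (proj (true, false, false, false, false)) := l00.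
have b1 : loop 0 (proj (false, true, false, false, false)).
  by have := loopD l00 l10; rewrite -projD.
have b2 : loop 0 (proj (false, false, true, false, false)).
  by have := loopD l00 l01; rewrite -projD.
have b3 : loop 0 (proj (false, false, false, true, false)).
  by have := loopD l00 l20; rewrite -projD.
have b4 : loop 0 (proj (false, false, false, false, true)).
  by have := loopD l21 (loopD l00 (loopD b2 b3)); rewrite -!projD.
have bz : loop 0 (proj 0) by move=> k e'; rewrite proj0 addr0.
have [[[[[v0 v1] v2] v3] v4] <-] := proj_surj e.
have -> : (v0, v1, v2, v3, v4) =
  (if v0 then (true, false, false, false, false) else 0) +
  ((if v1 then (false, true, false, false, false) else 0) +
  ((if v2 then (false, false, true, false, false) else 0) +
  ((if v3 then (false, false, false, true, false) else 0) +
  (if v4 then (false, false, false, false, true) else 0)))) :> V5.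
  by case: v0 v1 v2 v3 v4 => [] [] [] [] [].
by rewrite !projD; do !apply: loopD; case: ifP.
Qed.

Lemma cover_connected x y : conn x y.
Proof.
suff from0 z k e : conn (0, (false, false), 0) (z, k, e).
  by case: x y => [[z k] e] [[z' k'] e'];
    apply: connect_trans (conn_sym (from0 z k e)) (from0 z' k' e').
move: z k e; apply: T_gen => [k e|z d IH k e].
  apply: connect_trans (conn_dir _ _ k _) _.
  by have := loop_all e k 0; rewrite add0r.
have := connect_trans (IH k (e + proj (volt (pr z) d))) (conn_move _ _ d _).
by rewrite -addrA eE addr0.
Qed.

Let equiv (g : cover -> cover) :=
  forall x, g (cface x) = cface (g x) /\ g (cedge x) = cedge (g x).

Let hom x y := exists2 g : cover -> cover, g x = y & equiv g.

Let hom_trans x x1 y : hom x x1 -> hom x1 y -> hom x y.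
Proof.
move=> [g <- gC] [h <- hC]; exists (h \o g) => // {}x /=.
by rewrite !(gC x).1 !(gC x).2 (hC _).1 (hC _).2.
Qed.

Let homE z k e e' : hom (z, k, e) (z, k, e').
Proof.
exists (fun x : cover => (x.1, x.2 + (e + e'))) => /=.
  by rewrite addrA eE add0r.
by move=> x; split=> //; congr (_, _); rewrite addrAC.
Qed.

Let lift_lin (M : V5 -> V5) : (forall v v', M (v + v') = M v + M v') ->
  (forall v, proj v = 0 -> proj (M v) = 0) ->
  exists ME : E -> E, forall v, ME (proj v) = proj (M v).
Proof.
move=> MD M0; have [sec secP] := choice proj_surj.
exists (fun e => proj (M (sec e))) => v.
have : proj (M (sec (proj v) + v)) = 0.
  by apply: M0; rewrite projD secP eE.
rewrite MD projD => h; apply: (addIr (proj (M v))).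
by rewrite h eE.
Qed.

(** The map on [E] induced by [linX] exists because the kernel of [proj] is stable under it; the
    sheet of the image is then corrected by [homE]. *)
Let homX z k e e' : hom (z, k, e) (z + u, k, e').
Proof.
have [ME MEP] := lift_lin linXD proj_linX.
pose g (x : cover) : cover := (x.1.1 + u, x.1.2, ME x.2 + proj (gaugeX (pr x.1.1))).
apply: hom_trans (homE _ _ _ _); exists g; first by [].
case=> [[z' k'] e'']; split=> //; rewrite /g /cedge /=.
have [v <-] := proj_surj e''; rewrite -projD !MEP.
have -> : pr (z' + u) = step4 (false, false) (pr z') by rewrite -pr_step.
rewrite pr_step.
congr (_, _, _); first by rewrite addrAC.
by rewrite -!projD linXD -!addrA linX_volt.
Qed.

Let homR z k e e' : hom (z, k, e) (J z, inc4 k, e').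
Proof.
have [ME MEP] := lift_lin linRD proj_linR.
pose g (x : cover) : cover := (J x.1.1, inc4 x.1.2, ME x.2 + proj (gaugeR (pr x.1.1))).
apply: hom_trans (homE _ _ _ _); exists g; first by [].
case=> [[z' k'] e'']; split=> //; rewrite /g /cedge /=.
have [v <-] := proj_surj e''; rewrite -projD !MEP pr_step pr_rot JD J_dirv.
congr (_, _, _).
by rewrite -!projD linRD -!addrA linR_volt.
Qed.

Let inc4_4 k : inc4 (inc4 (inc4 (inc4 k))) = k.
Proof. by case: k => [[] []]. Qed.

Let hom_move z k d e e' : hom (z, k, e) (z + dirv d, k, e').
Proof.
have R z1 k1 := homR z1 k1 0 0; have X z1 k1 := homX z1 k1 0 0.
apply: hom_trans (homE z k e 0) _; apply: hom_trans _ (homE _ _ 0 e').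
case: d => [[] []]; rewrite /dirv /=.
- have := hom_trans (R z k) (hom_trans (X _ _) (hom_trans (R _ _)
    (hom_trans (R _ _) (R _ _)))).
  by rewrite inc4_4 !JD !JJ opprK.
- have := hom_trans (R z k) (hom_trans (R _ _) (hom_trans (R _ _)
    (hom_trans (X _ _) (R _ _)))).
  by rewrite inc4_4 !JD !JJ opprK.
- have := hom_trans (R z k) (hom_trans (R _ _) (hom_trans (X _ _)
    (hom_trans (R _ _) (R _ _)))).
  by rewrite inc4_4 !JD !JJ opprK.
- exact: X.
Qed.

Lemma cover_homogeneous x y : hom x y.
Proof.
have shift (t : T) : forall z k e e', hom (z, k, e) (z + t, k, e').
  move: t; apply: T_gen => [z k e e'|t d IH z k e e'].
    by rewrite addr0; apply: homE.
  by rewrite addrA; apply: hom_trans (IH z k e e) (hom_move _ _ _ _ _).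
have turn z k e : hom (z, k, e) (z, inc4 k, e).
  have := hom_trans (homR z k e e) (shift (z - J z) _ _ _ e).
  by rewrite addrCA subrr addr0.
case: x y => [[z k] e] [[z' k'] e']; have [j <-] := four_iter k k'.
have := shift (z' - z) z k e e'; rewrite addrCA subrr addr0 => /hom_trans; apply.
elim: j => [|j IH]; first exact: homE.
exact: hom_trans IH (turn _ _ _).
Qed.

(** A step in direction [d] relative to the heading of [x], which is kept. Being a word in [cface]
    and [cedge], it makes sense for any map respecting these two, and reversing [cface] turns [d]
    into [opp4 d]. *)
Let go d x : cover :=
  (x.1.1 + dirv (add4 x.1.2 d), x.1.2,
   x.2 + proj (volt (pr x.1.1) (add4 x.1.2 d))).

Let goE z e d :
  go d (z, (false, false), e) = (z + dirv d, (false, false), e + proj (volt (pr z) d)).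
Proof. by case: d => [[] []]. Qed.

Let go_word z e w : foldl (fun x d => go d x) (z, (false, false), e) w =
  (z + \sum_(d <- w) dirv d, (false, false), e + proj (voltw (pr z) w)).
Proof.
elim: w z e => [|d w IH] z e /=; first by rewrite big_nil proj0 !addr0.
by rewrite goE IH big_cons pr_step projD !addrA.
Qed.

Let go_rot d x : go d x = match d with
  | (false, false) => cface (cface (cedge x))
  | (true, false) => cface (cedge (cface x))
  | (false, true) => cedge (cface (cface x))
  | (true, true) => cface (cface (cface (cedge (cface (cface (cface x))))))
  end.
Proof. by case: x d => [[z [[] []]] e] [[] []]. Qed.

Let go_rot' d x : go (opp4 d) x = match d with
  | (false, false) => cface' (cface' (cedge x))
  | (true, false) => cface' (cedge (cface' x))
  | (false, true) => cedge (cface' (cface' x))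
  | (true, true) => cface' (cface' (cface' (cedge (cface' (cface' (cface' x))))))
  end.
Proof. by case: x d => [[z [[] []]] e] [[] []]. Qed.

(* A reflection at the base flag turns the walk w into its mirror image. *)
Lemma cover_irreflexible w : \sum_(d <- w) dirv d = 0 ->
  proj (voltw q0 w) = 0 -> proj (voltw q0 (map opp4 w)) <> 0 ->
  forall g : cover -> cover,
  ~ (forall x, g (cface x) = cface' (g x) /\ g (cedge x) = cedge (g x)).
Proof.
move=> sum0 volt0 mirror g gC; pose x0 : cover := (0, (false, false), 0).
(* Homogeneity moves the reflected base flag back, so the reflection may be assumed to fix it. *)
have [h hx hC] := cover_homogeneous (g x0) x0.
have h' x : h (cface' x) = cface' (h x).
  by apply: (can_inj cfaceK); rewrite -(hC _).1 !cfaceK'.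
pose g' := h \o g.
have g's x : g' (cface x) = cface' (g' x) by rewrite /g' /= (gC x).1 h'.
have g't x : g' (cedge x) = cedge (g' x) by rewrite /g' /= (gC x).2 (hC _).2.
have g'go d x : g' (go d x) = go (opp4 d) (g' x).
  by rewrite go_rot go_rot'; case: d => [[] []]; rewrite !(g's, g't).
have g'word v x : g' (foldl (fun x d => go d x) x v) =
    foldl (fun x d => go d x) (g' x) (map opp4 v).
  by elim: v x => //= d v IH x; rewrite IH g'go.
apply: mirror; have := g'word w x0.
rewrite /x0 go_word pr0 sum0 volt0 !addr0 -/x0 (_ : g' x0 = x0) // go_word pr0.
by move=> /(congr1 snd) /=; rewrite add0r => <-.
Qed.

Theorem cover_chiral w : \sum_(d <- w) dirv d = 0 ->
  proj (voltw q0 w) = 0 -> proj (voltw q0 (map opp4 w)) <> 0 ->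
  exists P, chiral_of_order_type (#|T| * 4 * #|E|) 4 8 P.
Proof.
move=> sum0 volt0 mirror.
have <- : #|cover| = (#|T| * 4 * #|E|)%N by rewrite !card_prod card_bool.
pose x0 : cover := (0, (false, false), 0).
have irr := cover_irreflexible sum0 volt0 mirror.
eexists; exact: (rotary_chiral x0 cfaceK cfaceK' cedgeK (isT : 1 < 4)%N
  (isT : 1 < 8)%N cface_period cvert_period cface_cvert cover_connected
  cover_homogeneous irr).
Qed.

End TorusCover.
(** * Chiral polytopes of type {4,8} *)

Section TorusModel.

Lemma val_natr_Zp n (a : nat) : (1 < n)%N -> (a%:R : 'Z_n) = (a %% n)%N :> nat.
Proof. by move=> n1; rewrite Zp_nat /=; congr (_ %% _)%N; apply: Zp_cast. Qed.

Lemma natr_Zp_mod n (a b : nat) : (1 < n)%N -> (a = b %[mod n])%N ->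
  a%:R = b%:R :> 'Z_n.
Proof. by move=> n1 ab; apply: val_inj; rewrite /= !val_natr_Zp. Qed.

Lemma modn_scale c m n (a : nat) : (n %| c * m)%N ->
  (c * (a %% m) = c * a %[mod n])%N.
Proof.
move=> /dvdnP[q cm].
by rewrite [in RHS](divn_eq a m) mulnDr mulnCA cm mulnA modnMDl.
Qed.

(* Multiplication by c from Z/m to Z/n, well defined when n divides c m. *)
Definition scaleZ c m n (x : 'Z_m) : 'Z_n := (c * x)%:R.
Arguments scaleZ : clear implicits.

Lemma scaleZD c m n (x y : 'Z_m) : (1 < m)%N -> (1 < n)%N -> (n %| c * m)%N ->
  scaleZ c m n (x + y) = scaleZ c m n x + scaleZ c m n y.
Proof.
move=> m1 n1 cm; rewrite -natrD -mulnDr; apply: natr_Zp_mod => //=.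
rewrite -(modn_scale (x + y) cm); congr (c * (_ %% _) %% _)%N; exact: Zp_cast.
Qed.

Lemma scaleZ_comp c c' m n p (x : 'Z_m) : (1 < n)%N -> (1 < p)%N ->
  (p %| c' * n)%N -> scaleZ c' n p (scaleZ c m n x) = scaleZ (c' * c) m p x.
Proof.
move=> n1 p1 cn; apply: natr_Zp_mod => //.
by rewrite -mulnA -(modn_scale (c * x) cn) val_natr_Zp.
Qed.

Lemma scaleZ2 m n (x : 'Z_m) : scaleZ 2 m n x = scaleZ 1 m n x + scaleZ 1 m n x.
Proof. by rewrite /scaleZ mul1n -natrD addnn mul2n. Qed.

Lemma scaleZ1 m (x : 'Z_m) : scaleZ 1 m m x = x.
Proof. by rewrite /scaleZ mul1n natr_Zp. Qed.

Variables K L : nat.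
Hypotheses (L2 : (2 <= L)%N) (LK : (L <= K)%N) (KL : (K <= L.+1)%N).

(* Z[i] modulo (1 + i) ^ (K + L), in the basis 1, 1 + i. *)
Definition torus : Type := ('Z_(2 ^ K) * 'Z_(2 ^ L))%type.
HB.instance Definition _ := GRing.Zmodule.on torus.
HB.instance Definition _ := Finite.on torus.

Let K1 : (1 < 2 ^ K)%N. Proof. by rewrite -{1}(expn0 2) ltn_exp2l //; lia. Qed.
Let L1 : (1 < 2 ^ L)%N. Proof. by rewrite -{1}(expn0 2) ltn_exp2l //; lia. Qed.
Let LdK : (2 ^ L %| 2 ^ K)%N. Proof. exact: dvdn_exp2l. Qed.
Let Kd2L : (2 ^ K %| 2 * 2 ^ L)%N. Proof. by rewrite -expnS dvdn_exp2l. Qed.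
Let d4K : (4 %| 2 ^ K)%N. Proof. by rewrite -[4%N]/(2 ^ 2)%N dvdn_exp2l //; lia. Qed.
Let d4L : (4 %| 2 ^ L)%N. Proof. by rewrite -[4%N]/(2 ^ 2)%N dvdn_exp2l. Qed.

Local Notation down := (scaleZ 1 (2 ^ K) (2 ^ L)).
Local Notation up2 := (scaleZ 2 (2 ^ L) (2 ^ K)).
Local Notation red4 M := (scaleZ 1 (2 ^ M) 4).

(** Multiplication by i, since i (x + y (1 + i)) = (- x - 2 y) + (x + y) (1 + i). Doubling from
    Z/2^L to Z/2^K is well defined because K <= L + 1. *)
Definition torusJ (z : torus) : torus := (- z.1 - up2 z.2, down z.1 + z.2).
Definition torus1 : torus := (1, 0).

Let downD x y : down (x + y) = down x + down y.
Proof. by apply: scaleZD; rewrite ?mul1n. Qed.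
Let up2D x y : up2 (x + y) = up2 x + up2 y.
Proof. exact: scaleZD. Qed.
Let redKD x y : red4 K (x + y) = red4 K x + red4 K y.
Proof. by apply: scaleZD; rewrite ?mul1n. Qed.
Let redLD x y : red4 L (x + y) = red4 L x + red4 L y.
Proof. by apply: scaleZD; rewrite ?mul1n. Qed.

Let oppD (U U' : zmodType) (f : U -> U') :
  (forall x y, f (x + y) = f x + f y) -> forall x, f (- x) = - f x.
Proof.
move=> fD x; apply: (addrI (f x)); rewrite -fD !subrr.
by apply: (addrI (f 0)); rewrite -fD !addr0.
Qed.

Let zeroD (U U' : zmodType) (f : U -> U') :
  (forall x y, f (x + y) = f x + f y) -> f 0 = 0.
Proof. by move=> fD; apply: (addrI (f 0)); rewrite -fD !addr0. Qed.

Lemma torusJD x y : torusJ (x + y) = torusJ x + torusJ y.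
Proof.
rewrite /torusJ /= downD up2D; congr (_, _); last by rewrite addrACA.
by rewrite !opprD addrACA.
Qed.

Lemma torusJJ x : torusJ (torusJ x) = - x.
Proof.
case: x => x y; rewrite /torusJ /= up2D !downD !(oppD downD).
rewrite !scaleZ_comp ?mul1n ?muln1 // !scaleZ2 !scaleZ1; congr (_, _).
  by rewrite !opprD !opprK addrACA -!opprD subrr addr0 opprD addrA subrr sub0r.
by rewrite addrACA addNr
  add0r opprD -addrA addNr addr0.
Qed.

Definition bits4 (x : 'Z_4) : four := (odd x, odd x./2).

Let bits4S (x : 'Z_4) : bits4 (x + 1) = inc4 (bits4 x).
Proof. by case: x => [[|[|[|[|//]]]] ?]. Qed.
Let bits4B (x : 'Z_4) : bits4 (x - 1) = dec4 (bits4 x).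
Proof. by case: x => [[|[|[|[|//]]]] ?]. Qed.
Let bits4N (x : 'Z_4) : bits4 (- x) = opp4 (bits4 x).
Proof. by case: x => [[|[|[|[|//]]]] ?]. Qed.

Let scaleZ_1 m n : scaleZ 1 m n 1 = 1.
Proof. by rewrite /scaleZ mul1n. Qed.

(* For z = a + b i in the basis 1, 1 + i, the residues of a and b modulo 4. *)
Definition re4 (z : torus) : 'Z_4 := red4 K z.1 + red4 L z.2.
Definition im4 (z : torus) : 'Z_4 := red4 L z.2.

Let re4D z z' : re4 (z + z') = re4 z + re4 z'.
Proof. by rewrite /re4 /= redKD redLD addrACA. Qed.

Let im4D z z' : im4 (z + z') = im4 z + im4 z'.
Proof. exact: redLD. Qed.

Let re4N z : re4 (- z) = - re4 z. Proof. exact: (oppD re4D). Qed.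
Let im4N z : im4 (- z) = - im4 z. Proof. exact: (oppD im4D). Qed.

Let re4J z : re4 (torusJ z) = - im4 z.
Proof.
case: z => x y; rewrite /re4 /im4 /torusJ /= redKD redLD !(oppD redKD).
rewrite !scaleZ_comp ?mul1n ?muln1 // scaleZ2.
by rewrite addrACA addNr add0r opprD -addrA addNr addr0.
Qed.

Let im4J z : im4 (torusJ z) = re4 z.
Proof.
case: z => x y; rewrite /re4 /im4 /torusJ /= redLD.
by rewrite scaleZ_comp ?mul1n.
Qed.

Let re41 : re4 torus1 = 1.
Proof. by rewrite /re4 /= scaleZ_1 (zeroD redLD) addr0. Qed.

Let im41 : im4 torus1 = 0.
Proof. exact: (zeroD redLD). Qed.

Definition torus_red (z : torus) : four * four := (bits4 (re4 z), bits4 (im4 z)).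

Lemma torus_red0 : torus_red 0 = q0.
Proof. by rewrite /torus_red (zeroD re4D) (zeroD im4D). Qed.

Lemma torus_red_rot z : torus_red (torusJ z) = rot4 (torus_red z).
Proof. by rewrite /torus_red re4J im4J bits4N. Qed.

Lemma torus_red_step z k :
  torus_red (z + dirv torusJ torus1 k) = step4 k (torus_red z).
Proof.
rewrite /torus_red re4D im4D; case: k => [[] []]; rewrite /dirv /=.
- by rewrite re4N im4N re4J im4J im41 re41 !oppr0 addr0 bits4B.
- by rewrite re4J im4J im41 re41 oppr0 addr0 bits4S.
- by rewrite re4N im4N im41 re41 oppr0 addr0 bits4B.
- by rewrite im41 re41 addr0 bits4S.
Qed.

Lemma torus_gen (A : torus -> Prop) : A 0 ->
  (forall z k, A z -> A (z + dirv torusJ torus1 k)) -> forall z, A z.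
Proof.
move=> A0 AS [x y].
have mulE (w : torus) m : w *+ m = (w.1 *+ m, w.2 *+ m).
  by elim: m => [|m IH]; rewrite ?mulr0n // !mulrS IH.
have -> : (x, y) = torus1 *+ (x + y) + torusJ torus1 *+ y :> torus.
  rewrite !mulE /torusJ /= (zeroD up2D) subr0 scaleZ_1 addr0.
  congr (_, _); last by rewrite mul0rn; symmetry; rewrite [LHS]add0r; apply: natr_Zp.
  rewrite mulNrn mulrnDr; symmetry; apply: etrans (addrK _ _) _; exact: natr_Zp.
move: (x + y)%N => i; elim: (nat_of_ord y) => [|m IH].
  rewrite addr0; elim: i => // i IH; rewrite mulrSr.
  exact: (AS _ (false, false)).
rewrite mulrSr addrA; exact: (AS _ (true, false)).
Qed.

Lemma card_torus : #|{: torus}| = (2 ^ (K + L))%N.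
Proof. by rewrite card_prod !card_ord !Zp_cast // expnD. Qed.

End TorusModel.

(** * Existence for every n >= 10 *)

HB.instance Definition _ := GRing.Zmodule.on V5.
HB.instance Definition _ := Finite.on V5.

Definition V4 : Type := (bool * bool * bool * bool)%type.
HB.instance Definition _ := GRing.Zmodule.on V4.
HB.instance Definition _ := Finite.on V4.

Local Notation east := (false, false).
Local Notation north := (true, false).
Local Notation west := (false, true).
Local Notation south := (true, true).

(* The boundary of an S-tetromino; its mirror image bounds a Z-tetromino. *)
Definition tetromino : seq four :=
  [:: east; east; north; west; north; west; west; south; east; south].

Lemma exists_chiral_4_8_large n : (11 <= n)%N ->
  exists P, chiral_of_order_type (2 ^ n) 4 8 P.
Proof.
(* Four directions and 2^5 sheets contribute 2^7, so the torus has 2 ^ (n - 7) points. Residues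
   modulo 4 require L >= 2, hence n >= 11. *)
move=> n11; pose L := ((n - 7) %/ 2)%N; pose K := (n - 7 - L)%N.
have L2 : (2 <= L)%N by rewrite /L; lia.
have LK : (L <= K)%N by rewrite /K /L; lia.
have KL : (K <= L.+1)%N by rewrite /K /L; lia.
have -> : (2 ^ n = #|{: torus K L}| * 4 * #|{: V5}|)%N.
  rewrite card_torus // !card_prod card_bool -[4%N]/(2 ^ 2)%N.
  rewrite -[(2 * 2 * 2 * 2 * 2)%N]/(2 ^ 5)%N -!expnD.
  by congr (2 ^ _)%N; rewrite /K /L; lia.
apply: (@cover_chiral _ _ _ _ (@torusJD K L L2 LK KL) (torusJJ L2 LK KL)
  (torus_red0 L2 LK KL) (torus_red_step L2 LK KL) (torus_red_rot L2 LK KL)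
  (torus_gen L2 LK KL) V5 id _ _ _ _ _ tetromino) => //.
- by move=> e; exists e.
- by move=> _ ->.
- by move=> _ ->.
- by move=> _ ->.
rewrite (perm_big [:: east; west; east; west; east; west;
  north; south; north; south]) //= !big_cons big_nil /dirv /=.
by rewrite addr0 !addNKr subrr.
Qed.

(* Closed modulo 4 only, hence specific to the smallest order: the last bit of the
   voltage group, in which a tetromino and its mirror image differ, is dropped. *)
Definition torus_walk : seq four :=
  [:: east; east; north; east; south; south; east; north].

Lemma exists_chiral_4_8_10 : exists P, chiral_of_order_type (2 ^ 10) 4 8 P.
Proof.
have l22 : (2 <= 2)%N by [].
have k23 : (2 <= 3)%N by [].
have -> : (2 ^ 10 = #|{: torus 2 2}| * 4 * #|{: V4}|)%N.
  by rewrite card_torus // !card_prod card_bool.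
pose proj (v : V5) : V4 := v.1.
have proj0 (v : V5) : proj v = 0 -> v.1 = (false, false, false, false) by [].
apply: (@cover_chiral _ _ _ _ (@torusJD 2 2 l22 l22 k23)
  (torusJJ l22 l22 k23) (torus_red0 l22 l22 k23) (torus_red_step l22 l22 k23)
  (torus_red_rot l22 l22 k23) (torus_gen l22 l22 k23) V4 proj _ _ _ _ _ torus_walk) => //.
- by move=> e; exists (e, false).
- by case=> v b /proj0 /= ->.
- by case=> v b /proj0 /= ->.
- by case=> v b /proj0 /= ->.
(* North and south cancel; the four steps east add up to 4, which vanishes on this torus. *)
rewrite (perm_big [:: north; south; north; south; east; east; east; east]) //=.
rewrite !big_cons big_nil /dirv /= !addNKr addr0.
by apply/eqP.
Qed.

Lemma exists_chiral_4_8 n : (10 <= n)%N ->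
  exists P, chiral_of_order_type (2 ^ n) 4 8 P.
Proof.
rewrite leq_eqVlt => /orP[/eqP <-|]; first exact: exists_chiral_4_8_10.
exact: exists_chiral_4_8_large.
Qed.

Lemma type_le_4_8 (a b : nat) : (1 < a)%N -> (1 < b)%N -> ~ (a = 2 /\ b = 2)%N ->
  type_le 4 8 (2 ^ a) (2 ^ b).
Proof.
move=> a1 b1 ab; rewrite /type_le leq_max leq_min.
rewrite !(@leq_exp2l 2 2) // !(@leq_exp2l 2 3) // a1 b1 /=.
by apply/orP; lia.
Qed.

Theorem corollary1p5 (n : nat) (hn : (10 <= n)%N) :
  [/\ smallest_chiral_type (2 ^ n) 4 8,
      ~ (exists P : polytope3, chiral_of_order_type (2 ^ n) 4 4 P),
      exists P : polytope3, chiral_of_order_type (2 ^ n) 4 8 P &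
      forall P : polytope3, chiral_of_order_type (2 ^ n) 4 8 P ->
        euler_characteristic P (- (2 ^ (n - 3))%N%:Z) /\
        carrier_genus P (2 ^ (n - 4) + 1)].
Proof.
have ex := exists_chiral_4_8 hn; split=> //.
- split=> // a b a1 b1 [P chP]; apply: type_le_4_8 => // -[a2 b2].
  by rewrite a2 b2 in chP; apply: (@no_chiral_4_4 P n).
- by move=> [P]; apply: no_chiral_4_4.
- by move=> P; apply: chiral_4_8_euler.
Qed.
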